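(* Let $\xi$ and $\eta$ be jointly stationary and ergodic random measures on $\mathbb{R}^d$ ($d\ge 1$). Assume that $\xi$ is diffuse (has no atoms, almost surely) and that $0<\lambda_\xi=\lambda_\eta<\infty$. Then there exists an allocation balancing $\xi$ and $\eta$ provided one of the following conditions holds: (a) $\eta$ has a non-zero discrete component (i.e. with positive probability $\eta$ has an atom; equivalently, by ergodicity, almost surely); (b) $\eta$ is diffuse and there exists an auxiliary point process $\chi$.
   Context: Framework: $(\Omega,\mathcal{F},\mathbb{P})$ is a probability space equipped with a measurable flow $(\theta_x)_{x\in\mathbb{R}^d}$: maps $\theta_x:\Omega\to\Omega$ such that $(\omega,x)\mapsto\theta_x\omega$ is measurable, $\theta_0$ is the identity and $\theta_x\circ\theta_y=\theta_{x+y}$. $\mathbb{P}$ is stationary ($\mathbb{P}\circ\theta_x=\mathbb{P}$ for all $x$) and ergodic (every $A\in\mathcal{F}$ with $\theta_xA=A$ for all $x$ has $\mathbb{P}(A)\in\{0,1\}$). A random measure $\xi$ on $\mathbb{R}^d$ is a kernel from $\Omega$ to $\mathcal{B}(\mathbb{R}^d)$ with $\xi(\omega,C)<\infty$ for a.e. $\omega$ and all compact $C$; a point process additionally takes values in $\mathbb{N}_0$, and is simple if a.s. $\xi(\{x\})\in\{0,1\}$ for all $x$. A random measure is stationary if $\xi(\theta_x\omega,C-x)=\xi(\omega,C)$ for all Borel $C$, $x\in\mathbb{R}^d$, $\mathbb{P}$-a.e. $\omega$. ''Random measures $\xi,\eta$ (and $\chi$) are jointly stationary and ergodic'' means they are all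 stationary random measures in this sense on such a stationary ergodic flow space. The intensity is $\lambda_\xi:=\mathbb{E}\,\xi([0,1]^d)$. An allocation is a measurable map $\tau:\Omega\times\mathbb{R}^d\to\mathbb{R}^d\cup\{\infty\}$ with $\tau(\theta_y\omega,x-y)=\tau(\omega,x)-y$ for all $x,y$ and $\mathbb{P}$-a.e. $\omega$. An allocation $\tau$ balances $\xi$ and $\eta$ if almost surely $\xi(\{s:\tau(s)=\infty\})=0$ and $\int\mathbf{1}\{\tau(s)\in C\}\,\xi(ds)=\eta(C)$ for all Borel $C\subset\mathbb{R}^d$. An auxiliary point process is a non-zero simple point process $\chi$ on $\mathbb{R}^d$ with finite intensity $\lambda_\chi$ such that $\xi,\eta,\chi$ are jointly stationary and ergodic (i.e. $\chi$ is defined on the same flow space and is stationary). *)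

(* Defs.v *)
From HB Require Import structures.
From mathcomp Require Import all_boot all_order all_algebra.
From mathcomp Require Import all_classical all_reals all_analysis.

Set Implicit Arguments.
Unset Strict Implicit.
Unset Printing Implicit Defensive.

Import Order.TTheory GRing.Theory Num.Theory.
Import numFieldNormedType.Exports.

Local Open Scope classical_set_scope.
Local Open Scope ring_scope.

(* R^d is modelled as the row vectors 'rV[R]_d, with their canonical
   (sup-norm, i.e. product) topology.  We equip them with the Borel
   sigma-algebra: the sigma-algebra generated by the open sets. *)
Section borel_rV.
Variables (R : realType) (d : nat).

HB.instance Definition _ := @isMeasurable.Build default_measure_display
  'rV[R]_d <<s (@open 'rV[R]_d) >>
  (@sigma_algebra0 _ setT (@open 'rV[R]_d))
  (@sigma_algebraC _ (@open 'rV[R]_d))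
  (@sigma_algebra_bigcup _ setT (@open 'rV[R]_d)).
End borel_rV.

Section stationary_framework.
Local Open Scope ereal_scope.
Context {R : realType} {d : nat} {dO : measure_display} {Omega : measurableType dO}.
Implicit Types (P : probability Omega R) (theta : 'rV[R]_d -> Omega -> Omega).

Definition measurable_flow theta :=
  [/\ measurable_fun [set: Omega * 'rV[R]_d] (fun p => theta p.2 p.1),
      theta 0%R = id &
      forall x y, theta x \o theta y = theta (x + y)%R].

Definition stationary_prob P theta :=
  forall x (A : set Omega), measurable A -> P (theta x @^-1` A) = P A.

Definition ergodic P theta :=
  forall A : set Omega, measurable A -> (forall x, theta x @` A = A) ->
    P A = 0 \/ P A = 1.

Definition random_measure P (xi : R.-ker Omega ~> 'rV[R]_d) :=
  {ae P, forall w, forall C : set 'rV[R]_d, compact C -> xi w C < +oo}.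

Definition stationary_rm P theta (xi : R.-ker Omega ~> 'rV[R]_d) :=
  {ae P, forall w, forall (x : 'rV[R]_d) (C : set 'rV[R]_d), measurable C ->
     xi (theta x w) [set (c - x)%R | c in C] = xi w C}.

Definition diffuse P (xi : R.-ker Omega ~> 'rV[R]_d) :=
  {ae P, forall w, forall x : 'rV[R]_d, xi w [set x] = 0}.

Definition unit_cube : set 'rV[R]_d :=
  [set x | forall i, (0 <= x ord0 i <= 1)%R].

Definition intensity P (xi : R.-ker Omega ~> 'rV[R]_d) :=
  \int[P]_w xi w unit_cube.

Definition point_process P (chi : R.-ker Omega ~> 'rV[R]_d) :=
  random_measure P chi /\
  forall w (C : set 'rV[R]_d), measurable C ->
    chi w C = +oo \/ exists n : nat, chi w C = (n%:R)%:E.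

Definition simple_pp P (chi : R.-ker Omega ~> 'rV[R]_d) :=
  point_process P chi /\
  {ae P, forall w, forall x : 'rV[R]_d, chi w [set x] = 0 \/ chi w [set x] = 1}.

Definition auxiliary_pp P theta (chi : R.-ker Omega ~> 'rV[R]_d) :=
  [/\ simple_pp P chi,
      ~ {ae P, forall w, chi w [set: 'rV[R]_d] = 0},
      intensity P chi < +oo &
      stationary_rm P theta chi].

(* Allocations: tau w x = None encodes tau(w,x) = infinity. *)
Definition allocation P theta
    (tau : Omega -> 'rV[R]_d -> option 'rV[R]_d) :=
  [/\ measurable [set p : Omega * 'rV[R]_d | tau p.1 p.2 = None],
      (forall C : set 'rV[R]_d, measurable C ->
         measurable [set p : Omega * 'rV[R]_d |
                      exists2 y, tau p.1 p.2 = Some y & C y]) &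
      {ae P, forall w, forall x y : 'rV[R]_d,
         tau (theta y w) (x - y)%R = omap (fun z => z - y)%R (tau w x)}].

Definition balances P (xi eta : R.-ker Omega ~> 'rV[R]_d)
    (tau : Omega -> 'rV[R]_d -> option 'rV[R]_d) :=
  {ae P, forall w,
     xi w [set s | tau w s = None] = 0 /\
     forall C : set 'rV[R]_d, measurable C ->
       \int[xi w]_s ((\1_[set s | exists2 y, tau w s = Some y & C y] s : R)%:E)
       = eta w C}.

End stationary_framework.

(* Main.v *)
(* Every stationary [zeta] that is not diffuse has, by ergodicity, atoms of some mass >= eps
   in almost every realisation; [zeta] is [eta] in case (a) and the point process in case (b).
   Isolated such atoms p serve as origins: for small cells A, B of a grid, the sets p + A (p an
   atom isolated at the scale of the grid) are disjoint, and so are the sets p + B. A step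
   transports as much as possible of what is left of xi on p + A to what is left of eta on
   p + B, simultaneously for all p; as xi is diffuse, a quantile map along an injective
   measurable code R^d -> R does this. Running through all (countably many) pairs (A, B) leaves
   at most one of xi and eta with mass left over, since any two points lie in p + A and p + B
   for some pair. By mass transport the left-overs of xi and eta have the same finite mean, so
   by ergodicity both vanish almost surely.

   An allocation of the form tau w x = x + sigma (theta_x w) is equivariant for every w, so it
   suffices to construct the measurable displacement sigma on Omega. *)

Require Import Defs.
From HB Require Import structures.
From mathcomp Require Import all_boot all_order all_algebra.
From mathcomp Require Import all_classical all_reals all_analysis.
From mathcomp Require Import measurable_realfun lra ring.
Set Implicit Arguments.
Unset Strict Implicit.
Unset Printing Implicit Defensive.
Import Order.TTheory GRing.Theory Num.Theory.
Import numFieldNormedType.Exports.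
Local Open Scope classical_set_scope.
Local Open Scope ring_scope.

(** Measurability shapes the construction. The existence of a suitable point near the origin
    quantifies over uncountably many candidates, and so does the choice of one. But the points used
    as origins are atoms of [zeta], so [zeta] itself detects them: a measurable set of such points
    is non-empty iff [zeta] charges it, and if it has at most one element, the coordinates of that
    element follow from rational comparisons. The two measures are treated asymmetrically. Any
    amount of the diffuse [xi] can be cut out as a subset, so what is left of it is a random set.
    The measure [eta] may have atoms, which no subset can split, so what is left of it is a density
    between 0 and 1. A step moves the smaller of the two masses; one of the two cells is then
    exhausted, and stays so. The hypotheses hold almost surely, whereas ergodicity concerns strictly
    invariant sets; almost invariant events therefore need a 0-1 law of their own. Finiteness of the
    mean is what allows the transported mass to be cancelled. *)

Lemma count_bigcup_measurable d (T : measurableType d) (I : countType)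
    (P : set I) (F : I -> set T) :
  (forall i, P i -> measurable (F i)) -> measurable (\bigcup_(i in P) F i).
Proof.
move=> mF; rewrite bigcup_mkcond; apply: countable_bigcupT_measurable => //.
by move=> i; case: ifPn => //; rewrite inE => /mF.
Qed.

(** * Borel structure of R^n: coordinates, rational boxes, grid cells *)

Section row_vectors.
Context {R : realType} {n : nat}.
Local Notation V := 'rV[R]_n.
Implicit Types (x y : V).

Lemma measurable_coord i : measurable_fun setT (fun x : V => x ord0 i).
Proof.
apply: (measurability _ (RGenOpens.measurableE R)) => // _ [_ [a [b -> <-]]].
rewrite setTI; apply: sub_sigma_algebra; apply: open_comp => //.
by move=> x _; exact: coord_continuous.
Qed.

Definition rat_box (c : 'rV[rat]_n * 'rV[rat]_n) : set V :=
  [set x | forall i, ratr (c.1 ord0 i) < x ord0 i < ratr (c.2 ord0 i)].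

Lemma rat_box_nbhs x (A : set V) : nbhs x A ->
  exists2 c, rat_box c x & rat_box c `<=` A.
Proof.
case/nbhs_ballP => e /= e0 sA.
have lo i : {q : rat | x ord0 i - e < ratr q < x ord0 i}.
  by apply: cid; have [|q] := @rat_in_itvoo R (x ord0 i - e) (x ord0 i);
    [rewrite ltrBlDr ltrDl|rewrite in_itv/=; exists q].
have hi i : {q : rat | x ord0 i < ratr q < x ord0 i + e}.
  by apply: cid; have [|q] := @rat_in_itvoo R (x ord0 i) (x ord0 i + e);
    [rewrite ltrDl|rewrite in_itv/=; exists q].
exists (\row_i sval (lo i), \row_i sval (hi i)).
  move=> i /=; rewrite !mxE; case: (lo i) => q /= /andP[_ ->].
  by case: (hi i) => r /= /andP[-> _].
move=> y yb; apply: sA; split => // r i; rewrite (ord1 r) /=; move: (yb i) => /=; rewrite !mxE.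
case: (lo i) => q /= /andP[q1 q2]; case: (hi i) => s /= /andP[s1 s2] /andP[y1 y2].
rewrite /ball/= ltr_norml; apply/andP; split; lra.
Qed.

Lemma measurable_rat_box c : measurable (rat_box c).
Proof.
have -> : rat_box c = \bigcap_(i in [set: 'I_n])
   ((fun x : V => x ord0 i) @^-1` `]ratr (c.1 ord0 i), ratr (c.2 ord0 i)[%classic).
  by apply/seteqP; split => x xb i; have := xb i; rewrite /= ?in_itv //= ; apply.
apply: fin_bigcap_measurable => // i _; rewrite -[X in measurable X]setTI.
exact: measurable_coord.
Qed.

Lemma measurable_fun_rV d (T : measurableType d) (f : T -> V) :
  (forall i, measurable_fun setT (fun t => f t ord0 i)) -> measurable_fun setT f.
Proof.
move=> mf; apply: (measurability (@open V)) => // _ [U oU <-]; rewrite setTI.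
have -> : f @^-1` U = \bigcup_(c in [set c | rat_box c `<=` U]) (f @^-1` rat_box c).
  apply/seteqP; split => t.
    move=> Ut; have /rat_box_nbhs[c cx cU] : nbhs (f t) U by exact: open_nbhs_nbhs.
    by exists c.
  by move=> [c cU ct]; exact: cU.
apply: count_bigcup_measurable => c _.
have -> : f @^-1` rat_box c = \bigcap_(i in [set: 'I_n])
   ((fun t => f t ord0 i) @^-1` `]ratr (c.1 ord0 i), ratr (c.2 ord0 i)[%classic).
  by apply/seteqP; split => x xb i; have := xb i; rewrite /= ?in_itv //= ; apply.
apply: fin_bigcap_measurable => // i _; rewrite -[X in measurable X]setTI.
exact: mf.
Qed.

Lemma measurable_funD_rV d (T : measurableType d) (f g : T -> V) :
  measurable_fun setT f -> measurable_fun setT g ->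
  measurable_fun setT (fun t => f t + g t).
Proof.
move=> mf mg; apply: measurable_fun_rV => i.
under eq_fun do rewrite mxE.
by apply: measurable_funD; apply: (measurableT_comp (measurable_coord i)).
Qed.

Lemma measurable_funN_rV d (T : measurableType d) (f : T -> V) :
  measurable_fun setT f -> measurable_fun setT (fun t => - f t).
Proof.
move=> mf; apply: measurable_fun_rV => i.
under eq_fun do rewrite mxE.
by apply: measurableT_comp => //; apply: (measurableT_comp (measurable_coord i)).
Qed.

Lemma measurable_set1_rV x : measurable [set x].
Proof.
have -> : [set x] = \bigcap_(i in [set: 'I_n])
   ((fun y : V => y ord0 i) @^-1` [set x ord0 i]).
  apply/seteqP; split => [y -> //|y xy]; apply/rowP => i; exact: (xy i I).
apply: fin_bigcap_measurable => // i _; rewrite -[X in measurable X]setTI.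
exact: measurable_coord.
Qed.

Lemma image_translate (C : set V) x :
  [set (c - x)%R | c in C] = (fun y => y + x) @^-1` C.
Proof.
apply/seteqP; split => [_ [c Cc <-]|y Cy] /=; first by rewrite subrK.
by exists (y + x) => //; rewrite addrK.
Qed.

Lemma measurable_translate x : measurable_fun setT (fun y : V => y + x).
Proof. by apply: measurable_funD_rV => //; exact: measurable_cst. Qed.

Lemma measurable_preimage_translate (C : set V) x :
  measurable C -> measurable ((fun y => y + x) @^-1` C).
Proof. by move=> mC; rewrite -[X in measurable X]setTI; exact: measurable_translate. Qed.

Definition floor_rV (N : nat) x : 'rV[int]_n := \row_i Num.floor (N.+1%:R * x ord0 i).

Definition grid N i : set V := floor_rV N @^-1` [set i].

Lemma gridE N i : grid N i = [set x | forall k,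
   (i ord0 k)%:~R <= N.+1%:R * x ord0 k < (i ord0 k + 1)%:~R].
Proof.
apply/seteqP; split => x; rewrite /grid/=.
  by move=> <- k; rewrite mxE floor_itv.
move=> h; apply/rowP => k; rewrite mxE; apply: floor_def; exact: h.
Qed.

Lemma measurable_grid N i : measurable (grid N i).
Proof.
have -> : grid N i = \bigcap_(k in [set: 'I_n])
   ((fun x : V => N.+1%:R * x ord0 k) @^-1`
      `[(i ord0 k)%:~R, (i ord0 k + 1)%:~R[%classic).
  by rewrite gridE; apply/seteqP; split => x xb k; have := xb k; rewrite /= ?in_itv //= ; apply.
apply: fin_bigcap_measurable => // k _; rewrite -[X in measurable X]setTI.
by apply: measurable_funM => //; exact: measurable_coord.
Qed.

(** As [N.+1] is an integer, an integer is at most [a] iff its [N.+1]-fold is at most the floor of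
    [N.+1 * a]; that floor thus determines the floor of [a]. Finiteness on unit cells passes to
    finer cells this way. *)
Lemma grid_sub N i : exists j, grid N i `<=` grid 0 j.
Proof.
case: (pselect (grid N i !=set0)) => [[z iz]|]; last first.
  by move=> /set0P/negP/negPn/eqP ->; exists 0; exact: sub0set.
exists (floor_rV 0 z) => y iy; rewrite /grid/=; apply/rowP => k; rewrite !mxE !mul1r.
have {iz iy} : floor_rV N y = floor_rV N z by rewrite iz.
move=> /rowP/(_ k); rewrite !mxE => e.
have key (a b : R) : Num.floor (N.+1%:R * a) = Num.floor (N.+1%:R * b) ->
    Num.floor a <= Num.floor b.
  move=> ab; rewrite floor_ge_int.
  rewrite -(ler_pM2l (ltr0Sn R N)) -[N.+1%:R]/((Posz N.+1)%:~R) -intrM.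
  rewrite -floor_ge_int -ab floor_ge_int intrM ler_pM2l ?ltr0n//.
  exact: floor_le.
by apply/eqP; rewrite eq_le !key.
Qed.

Definition closed_box (a b : V) : set V := [set x | forall k, a ord0 k <= x ord0 k <= b ord0 k].

Lemma compact_closed_box a b : compact (closed_box a b).
Proof.
have := @rV_compact R n (fun k => `[a ord0 k, b ord0 k]%classic).
by under eq_set do under eq_forall do rewrite /= in_itv/=; apply => k; exact: segment_compact.
Qed.

Lemma measurable_closed_box a b : measurable (closed_box a b).
Proof.
have -> : closed_box a b = \bigcap_(k in [set: 'I_n])
   ((fun x : V => x ord0 k) @^-1` `[a ord0 k, b ord0 k]%classic).
  by apply/seteqP; split => x xb k; have := xb k; rewrite /= ?in_itv //= ; apply.
apply: fin_bigcap_measurable => // k _; rewrite -[X in measurable X]setTI.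
exact: measurable_coord.
Qed.

End row_vectors.

(** * Reals recovered from rational comparisons *)

Section cuts.
Context {R : realType}.

(** Turns countably many events [q < v] into the real [v], measurably and without any choice.
    Nothing is assumed of [E]: an infinite supremum becomes 0 through [fine]. *)
Definition dedekind (E : rat -> Prop) : R :=
  fine (ereal_sup [set (ratr q : R)%:E | q in [set q | E q]]).

Lemma dedekindE (E : rat -> Prop) (v : R) :
  (forall q, ratr q < v -> E q) -> (forall q, E q -> ratr q <= v) -> dedekind E = v.
Proof.
move=> lo hi; rewrite /dedekind; suff -> : ereal_sup [set (ratr q : R)%:E | q in [set q | E q]] = v%:E by [].
apply/eqP; rewrite eq_le; apply/andP; split.
  by apply: ge_ereal_sup => _ [q /= Eq <-]; rewrite lee_fin hi.
rewrite leNgt; apply/negP => h.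
have [q] : exists q : rat, (ereal_sup [set (ratr q : R)%:E | q in [set q | E q]] < (ratr q)%:E < v%:E)%E.
  move: h; case: (ereal_sup _) => [s|//|].
    rewrite lte_fin => /rat_in_itvoo[q]; rewrite in_itv/= => q_; exists q; by rewrite !lte_fin.
  move=> _; have /rat_in_itvoo[q] : v - 1 < v by rewrite ltrBlDr ltrDl.
  rewrite in_itv/= => /andP[_ qv]; exists q; by rewrite ltNyr lte_fin.
rewrite lte_fin => /andP[+ /lo Eq]; rewrite ltNge => /negP; apply.
by apply: ereal_sup_ubound; exists q.
Qed.

Lemma measurable_dedekind d (T : measurableType d) (E : rat -> set T) :
  (forall q, measurable (E q)) -> measurable_fun setT (fun t => dedekind (fun q => E q t)).
Proof.
move=> mE; apply: measurableT_comp => //.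
apply: (measurability _ (ErealGenOInfty.measurableE R)) => // _ [_ [x ->] <-].
rewrite setTI.
have -> : (fun t => ereal_sup [set (ratr q : R)%:E | q in [set q | E q t]]) @^-1` `]x%:E, +oo[ =
   \bigcup_(q in [set q : rat | x < ratr q]) E q.
  apply/seteqP; split => t /=; rewrite in_itv/= andbT.
    move=> /ereal_sup_gt[_ [q Eq <-]]; rewrite lte_fin => xq; by exists q.
  by move=> [q /= xq Eq]; apply: (@lt_le_trans _ _ (ratr q)%:E);
    [rewrite lte_fin|apply: ereal_sup_ubound; exists q].
by apply: count_bigcup_measurable => q _; exact: mE.
Qed.

End cuts.

Lemma measure_bigcup0 d (T : measurableType d) (R : realType)
    (m : {measure set T -> \bar R}) (I : countType) (D : set I) (F : I -> set T) :
  (forall i, D i -> measurable (F i)) -> (forall i, D i -> m (F i) = 0%E) ->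
  m (\bigcup_(i in D) F i) = 0%E.
Proof.
move=> mF F0; apply/negligibleP; first exact: count_bigcup_measurable.
rewrite bigcup_mkcond.
pose G (k : nat) := if (unpickle k : option I) is Some i then
  if i \in D then F i else set0 else set0.
apply: (@negligibleS _ _ _ _ (\bigcup_k G k)).
  by move=> x [i _ Fx]; exists (pickle i) => //; rewrite /G pickleK.
apply: negligible_bigcup => k; rewrite /G; case: unpickle => [i|]; last exact: negligible_set0.
case: ifPn => [/set_mem Di|_]; last exact: negligible_set0.
by apply/negligibleP; [exact: mF|exact: F0].
Qed.

(** * Locally finite kernels *)

Section locally_finite_kernels.
Local Open Scope ereal_scope.
Context {R : realType} {n : nat} d (X : measurableType d).
Local Notation V := 'rV[R]_n.

(** The unit cells numbered by natural numbers, ready for countable sums; a number that codes no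
    cell gives the empty set. *)
Definition cell (j : nat) : set V := [set x | pickle (floor_rV 0 x) = j].

Lemma cellE j : cell j = if (pickle_inv j : option 'rV[int]_n) is Some i then grid 0 i else set0.
Proof.
rewrite /cell /grid; apply/seteqP; split => x /=.
  by move=> <-; rewrite pickleK_inv.
by have := @pickle_invK 'rV[int]_n j; case: pickle_inv => //= i <- <-.
Qed.

Lemma measurable_cell j : measurable (cell j).
Proof. by rewrite cellE; case: pickle_inv => // i; exact: measurable_grid. Qed.

Lemma trivIset_cell : trivIset setT cell.
Proof. by move=> a b _ _ [x [<- <-]]. Qed.

Lemma bigcup_cell : \bigcup_j cell j = setT.
Proof. by apply/seteqP; split => // x _; exists (pickle (floor_rV 0 x)). Qed.

(** Tested on countably many cells instead of all compact sets, so that for a random measure it is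
    an event. *)
Definition locally_finite (m : set V -> \bar R) := forall i, m (grid 0 i) < +oo.

Lemma locally_finite_cell (m : {measure set V -> \bar R}) j :
  locally_finite m -> m (cell j) < +oo.
Proof. by move=> fm; rewrite cellE; case: pickle_inv => // ; rewrite measure0. Qed.

Variable k : X -> {measure set V -> \bar R}.
Hypothesis mk : forall U, measurable U -> measurable_fun setT (k ^~ U).
Hypothesis fk : forall x, locally_finite (k x).

Let k' : X -> {measure set V -> \bar R} := k.
HB.instance Definition _ := isKernel.Build _ _ _ _ _ k' mk.

(** Each [k x] is the sum of its restrictions to the cells. These are finite measures, for which the
    measure of a section depends measurably on [x]. *)
Lemma measurable_kernel_xsection (E : set (X * V)) : measurable E ->
  measurable_fun setT (fun x => k x (xsection E x)).
Proof.
move=> mE.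
have -> : (fun x => k x (xsection E x)) =
   (fun x => \sum_(j <oo) k x (xsection E x `&` cell j)).
  apply/funext => x; rewrite -[LHS]/(k x _) -[in LHS](setIT (xsection E x)).
  rewrite -bigcup_cell setI_bigcupr measure_semi_bigcup//.
  - by move=> j; apply: measurableI; [exact: measurable_xsection|exact: measurable_cell].
  - exact/trivIset_setIl/trivIset_cell.
  - rewrite -setI_bigcupr bigcup_cell setIT; exact: measurable_xsection.
apply: ge0_emeasurable_sum => // j _.
apply: (@measurable_prod_subset_xsection_kernel _ _ _ _ _ k' (cell j) (measurable_cell j) _ E mE).2.
(* The bound may depend on [x]; adding 1 makes it strict. *)
move=> x; exists (fine (k x (cell j)) + 1)%R => U mU.
rewrite /mrestr EFinD fineK; last by rewrite ge0_fin_numE// locally_finite_cell.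
apply: (@le_lt_trans _ _ (k x (cell j))).
  by apply: le_measure; rewrite ?inE//; [exact: measurableI (measurable_cell j)|exact: measurable_cell].
by rewrite lteDl// ?lte_fin// ge0_fin_numE// locally_finite_cell.
Qed.

Lemma measurable_kernel_section (E : set (X * V)) : measurable E ->
  measurable_fun setT (fun x => k x [set y | E (x, y)]).
Proof.
by move=> /measurable_kernel_xsection; rewrite /xsection; under eq_fun do under eq_set do rewrite inE.
Qed.

Import HBNNSimple.

Lemma measurable_kernel_integral (f : X * V -> \bar R) :
  (forall z, 0 <= f z) -> measurable_fun setT f ->
  measurable_fun setT (fun x => \int[k x]_y f (x, y)).
Proof.
move=> f0 mf; pose f_ := nnsfun_approx measurableT mf.
apply: (@measurable_fun_xsection_integral _ _ _ _ _ _ k f_).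
- by move=> a b ab; exact/nd_nnsfun_approx.
- by move=> z; exact/cvg_nnsfun_approx.
- by move => m r; exact: measurable_kernel_xsection.
Qed.

End locally_finite_kernels.

(** * Measures given by a density *)

Section measure_density.
Local Open Scope ereal_scope.
Context {R : realType} d (T : measurableType d).
Variables (m : {measure set T -> \bar R}) (f : T -> R).
Hypothesis f0 : forall x, (0 <= f x)%R.
Hypothesis mf : measurable_fun setT f.

(** The two proofs are arguments so that the measure structure can be attached to [mdensity f0 mf]
    itself. *)
Definition mdensity & (forall x, (0 <= f x)%R) & measurable_fun setT f :=
  fun A => \int[m]_(x in A) (f x)%:E.

Let md := mdensity f0 mf.

Let md0 : md set0 = 0. Proof. exact: integral_set0. Qed.

Let md_ge0 A : 0 <= md A.
Proof. by apply: integral_ge0 => x _; rewrite lee_fin. Qed.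

Let md_sigma_additive : semi_sigma_additive md.
Proof.
move=> F mF tF mUF; rewrite /md /mdensity ge0_integral_bigcup//.
- apply: is_cvg_ereal_nneg_natsum_cond => j _ _.
  by apply: integral_ge0 => x _; rewrite lee_fin.
- by apply/measurable_EFinP; exact: measurable_funTS.
- by move=> x _; rewrite lee_fin.
Qed.

HB.instance Definition _ := isMeasure.Build _ _ _
  (mdensity f0 mf) md0 md_ge0 md_sigma_additive.

End measure_density.

(** * An injective measurable code of R^n by real numbers *)

Section ternary.
Context {R : realType}.
Implicit Types (b : nat -> bool).

(** Base 3 with digits 0 and 1 only, as for the Cantor set: the digits after the first contribute at
    most 1/2, so the first one is read off by comparison with 1. The ambiguity of binary expansions
    does not arise. *)
Definition ternary_sum b : R ^nat := fun k => \sum_(i < k) (b i)%:R / 3 ^+ i.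

Definition ternary b : R := limn (ternary_sum b).

Lemma ternary_sumS b k :
  ternary_sum b k.+1 = (b 0%N)%:R + ternary_sum (fun i => b i.+1) k / 3.
Proof.
rewrite /ternary_sum big_ord_recl expr0 divr1 mulr_suml; congr (_ + _).
by apply: eq_bigr => i _; rewrite lift0 exprS invfM mulrA mulrAC.
Qed.

Lemma ternary_sum_bounds b k : 0 <= ternary_sum b k <= 3 / 2.
Proof.
elim: k b => [|k ih] b; first by rewrite /ternary_sum big_ord0 lexx/=; lra.
rewrite ternary_sumS; have /andP[] := ih (fun i => b i.+1).
by case: (b 0%N) => /= ? ?; apply/andP; split; lra.
Qed.

Lemma ternary_cvg b : ternary_sum b @ \oo --> ternary b.
Proof.
apply: nondecreasing_is_cvgn.
  by apply/nondecreasing_seqP => k; rewrite /ternary_sum big_ord_recr/= lerDl divr_ge0// exprn_ge0.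
exists (3 / 2) => _ [k _ <-]; by have /andP[] := ternary_sum_bounds b k.
Qed.

Lemma ternary_bounds b : 0 <= ternary b <= 3 / 2.
Proof.
apply/andP; split.
  by apply: limr_ge; [exact: ternary_cvg|apply: nearW => k; have /andP[] := ternary_sum_bounds b k].
by apply: limr_le; [exact: ternary_cvg|apply: nearW => k; have /andP[] := ternary_sum_bounds b k].
Qed.

Lemma ternaryS b : ternary b = (b 0%N)%:R + ternary (fun i => b i.+1) / 3.
Proof.
rewrite [LHS]/ternary; apply: cvg_lim => //; rewrite -(cvg_shiftS (ternary_sum b)).
rewrite [X in X @ _ --> _](_ : _ = fun k => (b 0%N)%:R + ternary_sum (fun i => b i.+1) k / 3); last first.
  by apply/funext => k; rewrite /= ternary_sumS.
apply: cvgD; first exact: cvg_cst.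
by apply: cvgMl; exact: ternary_cvg.
Qed.

Lemma ternary_head b : (1 <= ternary b) = b 0%N.
Proof.
rewrite ternaryS; have /andP[] := ternary_bounds (fun i => b i.+1).
case: (b 0%N) => /= ? ?; first by apply/idP; lra.
by apply/negbTE; rewrite -ltNge; lra.
Qed.

(** Strips [k] leading digits: each time the digit [1 <= t] is subtracted and the rest rescaled by
    3. *)
Fixpoint ternary_tail (k : nat) (t : R) : R :=
  if k is k'.+1 then
    3 * (ternary_tail k' t - (1 <= ternary_tail k' t)%R%:R)
  else t.

Lemma ternary_tailE b k : ternary_tail k (ternary b) = ternary (fun i => b (k + i)%N).
Proof.
elim: k => [//|k /= ->]; rewrite ternary_head addn0.
rewrite [X in X - _]ternaryS addn0 addrAC subrr add0r mulrC divfK//.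
by congr ternary; apply/funext => i; rewrite addnS.
Qed.

Lemma ternary_digit b k : (1 <= ternary_tail k (ternary b)) = b k.
Proof. by rewrite ternary_tailE ternary_head addn0. Qed.

Lemma measurable_ternary_tail k : measurable_fun setT (ternary_tail k).
Proof.
elim: k => [|k ih]; first exact: measurable_id.
apply: measurable_funM => //; apply: measurable_funB => //.
have -> : (fun t => (1 <= ternary_tail k t)%R%:R : R) = \1_(ternary_tail k @^-1` `[1, +oo[%classic).
  by apply/funext => t; rewrite indicE; congr (nat_of_bool _)%:R; apply/idP/idP; rewrite inE/= in_itv/= andbT.
by apply: measurable_indic; rewrite -[X in measurable X]setTI; exact: ih.
Qed.

End ternary.

Section coding.
Context {R : realType} {n : nat}.
Local Notation V := 'rV[R]_n.

(** The bits answer all questions [q < x_i] with [q] rational; the answers determine [x] as a family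
    of cuts. *)
Definition code_bit (x : V) (j : nat) : bool :=
  if (unpickle j : option ('I_n * rat)) is Some c then ratr c.2 < x ord0 c.1 else false.

Definition encode (x : V) : R := ternary (code_bit x).

Definition decode (t : R) : V :=
  \row_i dedekind (fun q : rat => 1 <= ternary_tail (pickle ((i, q) : 'I_n * rat)) t).

Lemma encodeK : cancel encode decode.
Proof.
move=> x; apply/rowP => i; rewrite mxE; apply: dedekindE => q.
  by move=> qx; rewrite ternary_digit /code_bit pickleK/=.
by rewrite ternary_digit /code_bit pickleK/= => /ltW.
Qed.

Lemma encode_bounds x : 0 <= encode x <= 3 / 2.
Proof. exact: ternary_bounds. Qed.

Lemma measurable_decode : measurable_fun setT decode.
Proof.
apply: measurable_fun_rV => i; under eq_fun do rewrite mxE.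
apply: (@measurable_dedekind R _ _ (fun q => [set t | 1 <= ternary_tail (pickle ((i, q) : 'I_n * rat)) t])) => q.
rewrite [X in measurable X](_ : _ = setT `&` ternary_tail (pickle ((i, q) : 'I_n * rat)) @^-1` `[1, +oo[%classic); last first.
  by apply/seteqP; split => t /=; rewrite in_itv/= andbT; tauto.
exact: measurable_ternary_tail.
Qed.

Lemma measurable_encode : measurable_fun setT encode.
Proof.
apply: (@measurable_fun_cvg _ _ _ _ (fun k x => ternary_sum (code_bit x) k)); last first.
  by move=> x _; exact: ternary_cvg.
move=> k; apply: measurable_sum => i; apply: measurable_funM => //.
rewrite /code_bit; case: unpickle => [c|]; last exact: measurable_cst.
have -> : (fun x : V => (ratr c.2 < x ord0 c.1)%R%:R : R) =
   \1_((fun x => x ord0 c.1) @^-1` `]ratr c.2, +oo[%classic).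
  by apply/funext => t; rewrite indicE; congr (nat_of_bool _)%:R; apply/idP/idP; rewrite inE/= in_itv/= andbT.
by apply: measurable_indic; rewrite -[X in measurable X]setTI; exact: measurable_coord.
Qed.

End coding.

(** * Transporting a diffuse measure by quantiles of the code *)

Section cumulative.
Context {R : realType} {n : nat}.
Local Notation V := 'rV[R]_n.
Variable m : {measure set V -> \bar R}.
Hypothesis mT : (m setT < +oo)%E.

(** The distribution function of the image of [m] under [encode]. It takes a bare set function so
    that it also applies to [src] and [tgt] below, which are defined before they are known to be
    measures. *)
Definition cumul (m : set V -> \bar R) (t : R) : R := fine (m [set x | encode x <= t]).

Lemma measurable_encode_le t : measurable [set x : V | encode x <= t].
Proof.
rewrite [X in measurable X](_ : _ = setT `&` encode @^-1` `]-oo, t]%classic).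
  exact: measurable_encode.
by apply/seteqP; split => x /=; rewrite in_itv/=; tauto.
Qed.

Let m_fin A : measurable A -> m A \is a fin_num.
Proof.
by move=> mA; rewrite ge0_fin_numE//; apply: le_lt_trans mT; apply: le_measure; rewrite ?inE.
Qed.

Lemma cumulE t : (cumul m t)%:E = m [set x | encode x <= t].
Proof. by rewrite fineK// m_fin//; exact: measurable_encode_le. Qed.

Lemma cumul_le s t : s <= t -> cumul m s <= cumul m t.
Proof.
move=> st; rewrite -lee_fin !cumulE; apply: le_measure; rewrite ?inE; [exact: measurable_encode_le..|].
by move=> x /= /le_trans; apply.
Qed.

Lemma cumul_lt0 t : t < 0 -> cumul m t = 0.
Proof.
move=> t0; rewrite /cumul [X in m X](_ : _ = set0) ?measure0//.
rewrite -subset0 => x /= xt; have /andP[+ _] := encode_bounds x.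
by rewrite leNgt (le_lt_trans xt).
Qed.

Lemma cumul_top t : 3 / 2 <= t -> cumul m t = fine (m setT).
Proof.
move=> t0; rewrite /cumul [X in m X](_ : _ = setT)//.
rewrite -subTset => x _ /=; have /andP[_] := encode_bounds x.
by move=> /le_trans; apply.
Qed.

Lemma cumul_leT t : cumul m t <= fine (m setT).
Proof.
rewrite -lee_fin cumulE fineK ?m_fin//.
by apply: le_measure; rewrite ?inE//; exact: measurable_encode_le.
Qed.

Lemma cumul_right u t : (forall s, t < s -> u <= cumul m s) -> u <= cumul m t.
Proof.
move=> h; rewrite -lee_fin cumulE.
pose F j := [set x : V | encode x <= t + j.+1%:R^-1].
have -> : [set x : V | encode x <= t] = \bigcap_j F j.
  apply/seteqP; split => x /= xt; first by move=> j _; rewrite /F/= (le_trans xt)// lerDl.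
  rewrite leNgt; apply/negP => tx.
  have [j] := ltr_add_invr tx; rewrite ltNge => /negP; apply; exact: xt.
have mF j : measurable (F j) by exact: measurable_encode_le.
have cF : (m \o F) @ \oo --> m (\bigcap_j F j).
  apply: nonincreasing_cvg_mu => //.
  - by rewrite -ge0_fin_numE// m_fin.
  - exact: bigcapT_measurable.
  - move=> a b ab; apply/subsetPset => x /= /le_trans; apply.
    by rewrite lerD2l lef_pV2 ?posrE// ler_nat.
rewrite -(cvg_lim _ cF)//; apply: lime_ge; first by apply/cvg_ex; eexists; exact: cF.
by apply: nearW => j; rewrite /= /F -cumulE lee_fin h// ltrDl.
Qed.

Hypothesis m_diffuse : forall x, m [set x] = 0%E.

(** Left continuity is where diffuseness enters: [encode] is injective, so each of its level sets
    has at most one point and is null. *)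
Lemma cumul_left u t : (forall s, s < t -> cumul m s <= u) -> cumul m t <= u.
Proof.
move=> h; rewrite -lee_fin cumulE.
pose F j := [set x : V | encode x <= t - j.+1%:R^-1].
have mF j : measurable (F j) by exact: measurable_encode_le.
have m_level : (m [set x | encode x = t] = 0)%E.
  have [[x xt]|none] := pselect (exists x : V, encode x = t).
    rewrite [X in m X](_ : _ = [set x]) ?m_diffuse//.
    by apply/seteqP; split => y /=; rewrite -xt; [exact: (can_inj encodeK)|move=> ->].
  rewrite [X in m X](_ : _ = set0) ?measure0//.
  by rewrite -subset0 => x xt; apply: none; exists x.
have mlev : measurable [set x : V | encode x = t].
  rewrite [X in measurable X](_ : _ = setT `&` encode @^-1` [set t]).
    exact: measurable_encode.
  by apply/seteqP; split => x /=; tauto.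
have -> : [set x : V | encode x <= t] = [set x | encode x = t] `|` \bigcup_j F j.
  apply/seteqP; split => x /=.
    rewrite le_eqVlt => /orP[/eqP ->|]; first by left.
    move=> /ltr_add_invr[j xj]; right; exists j => //.
    by rewrite /F/= lerBrDr ltW.
  move=> [-> //|[j _]]; rewrite /F/= => /le_trans; apply.
  by rewrite gerBl.
have mU : measurable (\bigcup_j F j) by exact: bigcupT_measurable.
apply: le_trans (measureU2 _ mlev mU) _; move: m_level => /= ->; rewrite add0e.
have cF : (m \o F) @ \oo --> m (\bigcup_j F j).
  apply: nondecreasing_cvg_mu => //.
  move=> a b ab; apply/subsetPset => x /= /le_trans; apply.
  by rewrite lerD2l lerN2 lef_pV2 ?posrE// ler_nat.
rewrite -(cvg_lim _ cF)//; apply: lime_le; first by apply/cvg_ex; eexists; exact: cF.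
by apply: nearW => j; rewrite /= /F -cumulE lee_fin h// ltrBlDr ltrDl.
Qed.

(** Continuity makes [cumul m] take the value [c] exactly, at [sup S], and the set in question is
    [encode x <= sup S]. So any prescribed mass can be cut out of a diffuse measure. *)
Lemma measure_cumul_le c : 0 <= c <= fine (m setT) ->
  m [set x | cumul m (encode x) <= c] = c%:E.
Proof.
move=> /andP[c0 cT].
(* The cutoff 3/2, an upper bound of all codes, keeps [S] bounded when [c] is the total mass;
   negative numbers such as -1 belong to [S] because no code lies below 0. *)
pose S := [set t | t <= 3 / 2 /\ cumul m t <= c].
have S1 : S (-1) by split; [lra|rewrite cumul_lt0//; lra].
have hS : has_sup S by split; [exists (-1)|exists (3 / 2) => t []].
have le_c : cumul m (sup S) <= c.
  apply: cumul_left => s sS; have [t [_ tc] st] := sup_gt (ex_intro _ _ S1) sS.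
  exact: le_trans (cumul_le (ltW st)) tc.
have ge_c : c <= cumul m (sup S).
  apply: cumul_right => s Ss; rewrite leNgt; apply/negP => sc.
  have [s32|s32] := leP s (3 / 2).
    have : s <= sup S by apply: ub_le_sup; [exact: hS.2|split => //; exact: ltW].
    by rewrite leNgt Ss.
  by move: sc; rewrite cumul_top ?ltW// ltNge cT.
rewrite -[c in RHS](@le_anti _ R (cumul m (sup S))) ?le_c ?ge_c// cumulE.
congr (m _); apply/seteqP; split => x /= h.
  apply: ub_le_sup; first exact: hS.2.
  by split => //; have /andP[_] := encode_bounds x.
exact: le_trans (cumul_le h) le_c.
Qed.

End cumulative.

Section image_measure.
Context d1 d2 (T1 : measurableType d1) (T2 : measurableType d2) {R : realType}.
Variables (m : {measure set T1 -> \bar R}) (f : T1 -> T2).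

Definition image_measure (mf : measurable_fun setT f) : {measure set T2 -> \bar R}.
Proof. by refine (pushforward m f : {measure set T2 -> \bar R}). Defined.

End image_measure.

Section transport.
Context {R : realType} {n : nat}.
Local Notation V := 'rV[R]_n.

(** The generalised inverse of [N]. Written as a cut, it is measurable in [u] and in any parameter
    on which [N] depends measurably. *)
Definition quantile (N : R -> R) (u : R) : R := dedekind (fun q => N (ratr q) < u).

(** Monotone rearrangement along the code: it moves the initial segment [transported] of [mu], whose
    mass is that of [c * nu], onto [c * nu]. *)
Definition transport (mu nu : set V -> \bar R) (c : R) (x : V) : V :=
  decode (quantile (fun t => c * cumul nu t) (cumul mu (encode x))).

Definition transported (mu nu : set V -> \bar R) (c : R) : set V :=
  [set x | cumul mu (encode x) <= c * fine (nu setT)].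

Variables mu nu : {measure set V -> \bar R}.
Hypotheses (muT : (mu setT < +oo)%E) (nuT : (nu setT < +oo)%E).
Hypothesis mu_diffuse : forall x, mu [set x] = 0%E.
Variable c : R.
Hypothesis c_ge0 : 0 <= c.
Hypothesis c_le : c * fine (nu setT) <= fine (mu setT).

Let N t := c * cumul nu t.

(** The Galois connection of a right-continuous distribution function and its generalised inverse.
    The range of [u] keeps the supremum finite: -1 is in the set since [N (-1) = 0], and no [q]
    beyond 3/2 is, since [N] has reached its top there. *)
Lemma quantile_le u t : 0 < u <= c * fine (nu setT) -> (quantile N u <= t) = (u <= N t).
Proof.
move=> /andP[u0 um].
have N_le s s' : s <= s' -> N s <= N s' by move=> ss; rewrite ler_wpM2l// cumul_le.
pose S := [set (ratr q : R)%:E | q in [set q | N (ratr q) < u]].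
have Sge : ((-1)%:E <= ereal_sup S)%E.
  apply: ereal_sup_ubound; exists (-1) => /=; last by rewrite rmorphN1.
  by rewrite rmorphN1 /N cumul_lt0 ?mulr0// ltrN10.
have Sle : (ereal_sup S <= (3 / 2)%:E)%E.
  apply: ge_ereal_sup => _ [q /= qu <-]; rewrite lee_fin leNgt; apply/negP => /ltW q2.
  by move: qu; rewrite /N cumul_top// ltNge um.
have Sq : (quantile N u)%:E = ereal_sup S.
  rewrite /quantile /dedekind -/S fineK// fin_numE.
  by case: (ereal_sup S) Sge Sle.
apply/idP/idP => h; last first.
  rewrite -lee_fin Sq; apply: ge_ereal_sup => _ [q /= qu <-]; rewrite lee_fin leNgt.
  apply/negP => /ltW /N_le; rewrite leNgt => /negP; apply.
  exact: lt_le_trans qu h.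
have [c0|c0] := eqVneq c 0; first by move: u0 um; rewrite c0 mul0r => /lt_le_trans /[apply]; rewrite ltxx.
have cp : 0 < c by rewrite lt_def c0.
rewrite /N -ler_pdivrMl//; apply: cumul_right => // s ts; rewrite ler_pdivrMl//.
have [q] := rat_in_itvoo ts; rewrite in_itv/= => /andP[tq qs].
apply: (@le_trans _ _ (N (ratr q))); last exact/N_le/ltW.
rewrite leNgt; apply/negP => qu.
have : ((ratr q)%:E <= (quantile N u)%:E)%E by rewrite Sq; apply: ereal_sup_ubound; exists q.
by rewrite lee_fin leNgt (le_lt_trans h).
Qed.

Lemma measurable_cumul (k : {measure set V -> \bar R}) :
  (k setT < +oo)%E -> measurable_fun setT (cumul k).
Proof. by move=> kT; apply: nondecreasing_measurable => // s t; exact: cumul_le. Qed.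

Let F (x : V) := cumul mu (encode x).
Let mF : measurable_fun setT F.
Proof. exact: measurableT_comp (measurable_cumul muT) measurable_encode. Qed.

Lemma measurable_quantile : measurable_fun setT (quantile N).
Proof.
apply: (@measurable_dedekind R _ _ (fun q => [set u | N (ratr q) < u])) => q.
rewrite [X in measurable X](_ : _ = `]N (ratr q), +oo[%classic)//.
by apply/seteqP; split => u /=; rewrite in_itv/= andbT.
Qed.

Lemma measurable_transported : measurable (transported mu nu c).
Proof.
rewrite [X in measurable X](_ : _ = setT `&` F @^-1` `]-oo, c * fine (nu setT)]%classic).
  exact: mF.
by apply/seteqP; split => x /=; rewrite in_itv/=; tauto.
Qed.

(** On the code line, the image of the transported part of [mu] and [c] times the image of [nu] are
    finite measures that agree on half-lines, hence everywhere. *)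
Lemma transportE C : measurable C ->
  mu (transported mu nu c `&` transport mu nu c @^-1` C) = (c%:E * nu C)%E.
Proof.
move=> mC.
have mQ : measurable_fun setT (quantile N \o F) by exact: measurableT_comp measurable_quantile mF.
pose m1 := image_measure (mrestr mu measurable_transported) mQ.
pose m2 := mscale (NngNum c_ge0) (image_measure nu measurable_encode).
have le_half t : m1 `]-oo, t]%classic = m2 `]-oo, t]%classic.
  have Nt : 0 <= N t <= fine (mu setT).
    rewrite mulr_ge0 ?fine_ge0//=; apply: le_trans c_le.
    by rewrite ler_wpM2l// cumul_leT.
  have Nm : N t <= c * fine (nu setT) by rewrite ler_wpM2l// cumul_leT.
  have -> : m2 `]-oo, t]%classic = (N t)%:E.
    rewrite /m2/= /mscale/= /pushforward EFinM; congr (_ * _)%E.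
    by rewrite cumulE//; congr (nu _); apply/seteqP; split => x /=; rewrite in_itv.
  rewrite -(measure_cumul_le muT mu_diffuse Nt) /m1/= /pushforward /mrestr.
  (* [quantile_le] needs a positive level; the points of level 0 form a [mu]-null set and are
     absorbed into the estimates. *)
  have mZ : measurable [set x | F x <= 0].
    rewrite [X in measurable X](_ : _ = setT `&` F @^-1` `]-oo, 0]%classic).
      exact: mF.
    by apply/seteqP; split => x /=; rewrite in_itv/=; tauto.
  have Z : mu [set x | F x <= 0] = 0%E.
    by rewrite measure_cumul_le// lexx fine_ge0.
  have mA : measurable [set x : V | cumul mu (encode x) <= N t].
    rewrite [X in measurable X](_ : _ = setT `&` F @^-1` `]-oo, N t]%classic).
      exact: mF.
    by apply/seteqP; split => x /=; rewrite in_itv/=; tauto.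
  have mB : measurable ((quantile N \o F) @^-1` `]-oo, t]%classic `&` transported mu nu c).
    apply: measurableI; last exact: measurable_transported.
    by rewrite -[X in measurable X]setTI; apply: (mQ measurableT).
  have key x : 0 < F x -> ((quantile N \o F) @^-1` `]-oo, t]%classic `&` transported mu nu c) x
      <-> cumul mu (encode x) <= N t.
    move=> F0; rewrite /= in_itv/= /transported/=; split => [[h1 h2]|h].
      by rewrite -quantile_le ?F0.
    have h2 := le_trans h Nm; split => //.
    by rewrite quantile_le// F0.
  apply/eqP; rewrite eq_le; apply/andP; split.
    rewrite -[leRHS]adde0 -Z; apply: le_trans (measureU2 _ mA mZ).
    apply: le_measure; rewrite ?inE//; first exact: measurableU.
    move=> x Bx; have [F0|F0] := leP (F x) 0; [by right|left].
    exact/key.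
  rewrite -[leRHS]adde0 -Z; apply: le_trans (measureU2 _ mB mZ).
  apply: le_measure; rewrite ?inE//; first exact: measurableU.
  move=> x Bx; have [F0|F0] := leP (F x) 0; [by right|left].
  exact/key.
have total : m1 setT = m2 setT.
  rewrite /m1 /m2/= /mscale/= /pushforward /mrestr !preimage_setT setTI.
  rewrite measure_cumul_le ?c_le ?mulr_ge0 ?fine_ge0//.
  by rewrite EFinM fineK// ge0_fin_numE.
have m1T : (m1 setT < +oo)%E.
  rewrite total /m2/= /mscale/= /pushforward preimage_setT.
  by rewrite lte_mul_pinfty// lee_fin.
(* The open upper half-lines form a generating pi-system; their complements are settled by
   [le_half], and finite total mass permits the subtraction. *)
have m12 : forall B, measurable B -> m1 B = m2 B.
  move=> B; apply: (@measure_unique _ R _ (@RGenOInfty.G R) (fun j => `](- j%:R)%R, +oo[%classic)).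
  - exact: RGenOInfty.measurableE.
  - move=> _ _ [x ->] [y ->]; exists (Num.max x y).
    by apply/seteqP; split => z /=; rewrite !in_itv/= !andbT gt_max => /andP.
  - by move=> i; exists (- i%:R).
  - rewrite -subTset => x _.
    exists (Num.bound `|x|) => //=; rewrite in_itv/= andbT.
    by have := archi_boundP (normr_ge0 x); rewrite ltr_norml => /andP[].
  - move=> _ [x ->]; rewrite -setCitvl -!setTD.
    rewrite !measureD//; first by rewrite !setTI; congr (_ - _)%E; [exact: total|exact: le_half].
    by have := m1T; rewrite total.
  - by move=> j; apply: le_lt_trans m1T; apply: le_measure; rewrite ?inE.
(* Back from codes to points: [decode] inverts [encode], so [m2] of this set is [c * nu C]. *)
have mdC : measurable (decode @^-1` C : set R).
  by rewrite -[X in measurable X]setTI; exact: measurable_decode.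
have := m12 _ mdC.
rewrite /m1 /m2/= /mscale/= /pushforward /mrestr setIC => ->.
congr (_ * nu _)%E; apply/seteqP; split => x /=; by rewrite encodeK.
Qed.

End transport.

(** * Almost invariant events *)

Section lebesgue_translation.
Local Open Scope ereal_scope.
Context {R : realType}.
Notation mu := (@lebesgue_measure R).

Lemma measurable_addr (a : R) : measurable_fun setT (fun t : measurableTypeR R => (t + a)%R : measurableTypeR R).
Proof. exact: measurable_funD. Qed.

Lemma lebesgue_measure_translate (a : R) A : measurable A ->
  mu A = image_measure mu (measurable_addr a) A.
Proof.
move=> mA; apply: lebesgue_measure_unique => // _ [[x y] _ <-] /=.
rewrite [RHS](_ : _ = mu [set` `](x - a)%R, (y - a)%R]]); last first.
  rewrite /pushforward; congr (mu _); apply/seteqP; split => z /=;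
    by rewrite !in_itv/= ltrBlDr lerBrDr.
rewrite !lebesgue_measure_itv/= !lte_fin ltrD2r; case: ifPn => // _.
by rewrite -!EFinB; congr EFin; ring.
Qed.

Lemma ge0_integral_translate (h : measurableTypeR R -> \bar R) (a : R) :
  measurable_fun setT h -> (forall t, 0 <= h t) ->
  \int[mu]_t h (t + a)%R = \int[mu]_t h t.
Proof.
move=> mh h0; transitivity (\int[image_measure mu (measurable_addr a)]_t h t).
  rewrite ge0_integral_pushforward ?preimage_setT//.
  exact: measurable_addr.
by apply: eq_measure_integral => A mA _; apply/esym; exact: lebesgue_measure_translate.
Qed.

End lebesgue_translation.

Section zero_one_law.
Local Open Scope ereal_scope.
Context {R : realType} {n : nat} {dO : measure_display} {Omega : measurableType dO}.
Variables (P : probability Omega R) (theta : 'rV[R]_n -> Omega -> Omega).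
Hypotheses (flow : measurable_flow theta).

Let theta0 w : theta 0%R w = w. Proof. by have [_ -> _] := flow. Qed.

Lemma flowD x y w : theta x (theta y w) = theta (x + y)%R w.
Proof. by have [_ _ <-] := flow. Qed.

Lemma measurable_flow2 d (T : measurableType d) (f : T -> Omega) (g : T -> 'rV[R]_n) :
  measurable_fun setT f -> measurable_fun setT g ->
  measurable_fun setT (fun t => theta (g t) (f t)).
Proof.
move=> mf mg; have [mt _ _] := flow.
exact: (measurableT_comp mt (measurable_fun_pair mf mg)).
Qed.

Lemma measurable_flow1 x : measurable_fun setT (theta x).
Proof. by apply: measurable_flow2 => //; exact: measurable_cst. Qed.

Let axis i (t : measurableTypeR R) : 'rV[R]_n := (t *: delta_mx ord0 i)%R.

Let measurable_axis i : measurable_fun setT (axis i).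
Proof.
apply: measurable_fun_rV => j; under eq_fun do rewrite !mxE.
by apply: measurable_funM => //; exact: measurable_cst.
Qed.

Definition line_integral i (f : Omega -> \bar R) (w : Omega) : \bar R :=
  \int[@lebesgue_measure R]_t f (theta (t *: delta_mx ord0 i)%R w).

Let J (s : seq 'I_n) (f : Omega -> \bar R) := foldr line_integral f s.

Let J_ge0 s f : (forall w, 0 <= f w) -> forall w, 0 <= J s f w.
Proof. by move=> f0; elim: s => //= i s ih w; apply: integral_ge0 => t _; exact: ih. Qed.

Let mJ s f : (forall w, 0 <= f w) -> measurable_fun setT f -> measurable_fun setT (J s f).
Proof.
move=> f0 mf; elim: s => //= i s ih.
have := @measurable_fun_fubini_tonelli_F _ _ _ _ R (@lebesgue_measure R)
  (fun p => J s f (theta (axis i p.2) p.1)).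
apply; last by move=> p; exact: J_ge0.
apply: (measurableT_comp ih); apply: measurable_flow2; first exact: measurable_fst.
by apply: (measurableT_comp (measurable_axis i)); exact: measurable_snd.
Qed.

(** If axis [i] is integrated further inside, commutativity of the flow moves the shift through the
    outer integral; if it is the outermost axis, Lebesgue measure absorbs the shift. *)
Let J_inv s f : (forall w, 0 <= f w) -> measurable_fun setT f ->
  forall i t w, i \in s -> J s f (theta (axis i t) w) = J s f w.
Proof.
move=> f0 mf; elim: s => //= j s ih i t w; rewrite inE.
have [ins _|nins] := boolP (i \in s).
  apply: eq_integral => u _; rewrite flowD addrC -flowD; exact: ih.
rewrite orbF => /eqP ->; rewrite /line_integral.
rewrite -(@ge0_integral_translate R (fun u => J s f (theta (axis j u) w)) t).
- by apply: eq_integral => u _; rewrite flowD -scalerDl.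
- apply: (measurableT_comp (mJ s f0 mf)); apply: measurable_flow2; first exact: measurable_cst.
  exact: measurable_axis.
- by move=> u; exact: J_ge0.
Qed.

(** 0 and [+oo] are reproduced by integration over a line of infinite length; no positive finite
    constant is, whence the factor [+oo] on indicators. *)
Let J_cst s f c w : c = 0 \/ c = +oo -> (forall x, f (theta x w) = c) -> J s f w = c.
Proof.
move=> c01; elim: s w => [w /(_ 0%R)|i s ih w fw] /=; first by rewrite theta0.
rewrite /line_integral (eq_integral (cst c)); last first.
  by move=> t _; apply: ih => x; rewrite flowD fw.
rewrite integral_cst//; case: c01 => ->; first by rewrite mul0e.
have : (0 < @lebesgue_measure R setT).
  rewrite -set_itvNyy lebesgue_measure_itv/=; exact: ltry.
by move=> h; rewrite gt0_mulye.
Qed.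

Let J_invT f : (forall w, 0 <= f w) -> measurable_fun setT f ->
  forall x w, J (enum 'I_n) f (theta x w) = J (enum 'I_n) f w.
Proof.
move=> f0 mf x; rewrite (row_sum_delta x).
apply: (@big_ind _ (fun y => forall w, J (enum 'I_n) f (theta y w) = J (enum 'I_n) f w)).
- by move=> w; rewrite theta0.
- by move=> y z hy hz w; rewrite -flowD hy hz.
- by move=> i _ w; apply: J_inv => //; rewrite mem_enum.
Qed.

Lemma measure_eq_ae (A B : set Omega) : measurable A -> measurable B ->
  {ae P, forall w, A w <-> B w} -> P A = P B.
Proof.
move=> mA mB [N [mN PN sN]].
have half (C D : set Omega) : measurable C -> measurable D -> C `\` D `<=` N -> P C <= P D.
  move=> mC mD CD; rewrite -[leRHS]adde0 -PN; apply: le_trans (measureU2 P mD mN).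
  apply: le_measure; rewrite ?inE//; first exact: measurableU.
  by move=> w Cw; have [Dw|Dw] := pselect (D w); [left|right; exact: CD].
apply/eqP; rewrite eq_le; apply/andP; split; apply: half => //= w [h1 h2];
  by apply: sN => /= h; apply: h2; apply/h.
Qed.

Hypothesis erg : ergodic P theta.

(* Ergodicity speaks about strictly invariant sets. Integrating [oo * 1_A] over all
   coordinate lines gives a strictly invariant function equal to [oo * 1_A] on [W]. *)
Lemma ae_invariant_0_1 (A W : set Omega) : measurable A ->
  {ae P, forall w, W w} -> (forall w, W w -> forall x, A (theta x w) <-> A w) ->
  P A = 0 \/ P A = 1.
Proof.
move=> mA aeW Ainv.
pose f w : \bar R := if w \in A then +oo else 0.
have f0 w : 0 <= f w by rewrite /f; case: ifPn.
have mf : measurable_fun setT f.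
  apply: measurable_fun_ifT => //; apply: (measurable_fun_bool true).
  rewrite setTI [X in measurable X](_ : _ = A)//.
  by apply/seteqP; split => w /=; [move/set_mem|move/mem_set].
pose B := [set w | J (enum 'I_n) f w = +oo].
have mB : measurable B.
  rewrite [X in measurable X](_ : _ = setT `&` J (enum 'I_n) f @^-1` [set +oo]).
    by apply: mJ => //; exact: emeasurable_set1.
  by apply/seteqP; split => w /=; tauto.
have JW w : W w -> J (enum 'I_n) f w = f w.
  move=> Ww; apply: J_cst; first by rewrite /f; case: ifPn; tauto.
  move=> x; rewrite /f; have [a b] := Ainv w Ww x.
  suff -> : (theta x w \in A) = (w \in A) by [].
  by apply/idP/idP; rewrite !inE.
have -> : P A = P B.
  apply: measure_eq_ae => //; apply: filterS aeW => w /JW; rewrite /B/= => ->.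
  by rewrite /f; case: ifPn; rewrite ?inE ?notin_setE.
apply: erg => // x; apply/seteqP; split => [_ [w Bw <-]|w Bw].
  by rewrite /B/= J_invT.
exists (theta (- x) w); first by rewrite /B/= J_invT.
by rewrite flowD subrr theta0.
Qed.

End zero_one_law.

(** * Measurability of comparisons, inverses and case distinctions *)

Section measurability_helpers.
Context {R : realType} d (T : measurableType d).

Lemma measurable_preimageT d' (T' : measurableType d') (f : T -> T') A :
  measurable_fun setT f -> measurable A -> measurable (f @^-1` A).
Proof. by move=> mf mA; rewrite -[X in measurable X]setTI; exact: mf. Qed.

Lemma measurable_set_lt (f g : T -> R) : measurable_fun setT f ->
  measurable_fun setT g -> measurable [set x | f x < g x].
Proof.
move=> mf mg; rewrite [X in measurable X](_ : _ = (fun x => f x < g x) @^-1` [set true])//.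
by apply: measurable_preimageT => //; exact: measurable_fun_ltr.
Qed.

Lemma measurable_set_le (f g : T -> R) : measurable_fun setT f ->
  measurable_fun setT g -> measurable [set x | f x <= g x].
Proof.
move=> mf mg; rewrite [X in measurable X](_ : _ = (fun x => f x <= g x) @^-1` [set true])//.
by apply: measurable_preimageT => //; exact: measurable_fun_ler.
Qed.

Lemma measurable_fun_inv_ge0 (f : T -> R) : (forall x, 0 <= f x) ->
  measurable_fun setT f -> measurable_fun setT (fun x => (f x)^-1).
Proof.
move=> f0 mf.
have -> : (fun x => (f x)^-1) = (fun x => f x `^ (-1)).
  by apply/funext => x; rewrite powR_inv1.
exact: (measurableT_comp (measurable_powR (-1)) mf).
Qed.

Lemma measurable_fun_if_set d' (T' : measurableType d') (A : set T) (f g : T -> T') :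
  measurable A -> measurable_fun setT f -> measurable_fun setT g ->
  measurable_fun setT (fun x => if x \in A then f x else g x).
Proof.
move=> mA mf mg; apply: measurable_fun_ifT => //; apply: (measurable_fun_bool true).
rewrite setTI [X in measurable X](_ : _ = A)//.
by apply/seteqP; split => w /=; [move/set_mem|move/mem_set].
Qed.

End measurability_helpers.

(** * Isolated atoms of the auxiliary measure *)

Section visits.
Local Open Scope ereal_scope.
Context {R : realType} {n : nat} {dO : measure_display} {Omega : measurableType dO}.
Local Notation V := 'rV[R]_n.
Variable theta : V -> Omega -> Omega.
Hypothesis flow : measurable_flow theta.

(** Stationarity at one realisation for all shifts at once, with [C + x] written as a preimage. *)
Definition equivariant_at (k : Omega -> set V -> \bar R) w :=
  forall x C, measurable C -> k (theta x w) C = k w ((fun z => z - x)%R @^-1` C).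

Variable zeta : Omega -> {measure set V -> \bar R}.
Hypothesis mzeta : forall U, measurable U -> measurable_fun setT (zeta ^~ U).
Hypothesis fzeta : forall w, locally_finite (zeta w).
Variable eps : R.
Hypothesis eps0 : (0 < eps)%R.

Definition cube (N : nat) : set V := [set x | forall i, (`|x ord0 i| < N.+1%:R^-1)%R].

Lemma measurable_cube N : measurable (cube N).
Proof.
have -> : cube N = \bigcap_(i in [set: 'I_n]) [set x : V | (`|x ord0 i| < N.+1%:R^-1)%R].
  by apply/seteqP; split => x xb i; [move=> _; exact: xb|exact: (xb i I)].
apply: fin_bigcap_measurable => // i _; apply: measurable_set_lt => //.
by apply: measurableT_comp => //; exact: measurable_coord.
Qed.

(** Matches the two scales: visits isolated at scale [N] have disjoint translates of any cell of
    [grid N]. *)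
Lemma grid_cube N i x y : grid N i x -> grid N i y -> cube N (x - y)%R.
Proof.
rewrite !gridE/= => xi yi k; rewrite !mxE.
have /andP[] := xi k; have /andP[] := yi k.
rewrite intrD => y1 y2 x1 x2.
rewrite -(ltr_pM2l (ltr0Sn R N)) mulfV ?pnatr_eq0// -[X in (X * `|_|)%R]ger0_norm//.
by rewrite -normrM mulrBr ltr_norml; apply/andP; split; lra.
Qed.

(** Isolation is meant only with respect to atoms of mass at least [eps]: the punctured cube may
    carry mass, but too little for a second one. Every such atom of a locally finite measure
    satisfies this for large [N]. *)
Definition visit N : set Omega :=
  [set w | eps%:E <= zeta w [set 0%R] /\ zeta w (cube N `\ 0%R) < eps%:E].

Lemma measurable_visit N : measurable (visit N).
Proof.
apply: measurableI; rewrite -[X in measurable X]setTI.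
  by apply: emeasurable_fun_c_infty => //; apply: mzeta; exact: measurable_set1_rV.
apply: emeasurable_fun_infty_o => //; apply: mzeta; apply: measurableD.
  exact: measurable_cube.
exact: measurable_set1_rV.
Qed.

Lemma equivariant_set1 (k : Omega -> {measure set V -> \bar R}) w x y :
  equivariant_at k w -> k (theta x w) [set y] = k w [set (y + x)%R].
Proof.
move=> kw; rewrite kw; last exact: measurable_set1_rV.
congr (k w _); apply/seteqP; split => z /=; first by move=> <-; rewrite subrK.
by move=> ->; rewrite addrK.
Qed.

Lemma visit_unique N w p q : equivariant_at zeta w ->
  visit N (theta p w) -> visit N (theta q w) -> cube N (q - p)%R -> p = q.
Proof.
move=> zw [_ vp] [vq _] pq; apply/eqP; rewrite eq_sym; apply: contraT => npq.
suff : eps%:E < eps%:E by rewrite ltxx.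
apply: le_lt_trans vp; apply: le_trans vq _.
rewrite (equivariant_set1 _ _ zw) add0r -[q in X in X <= _](subrK p) -(equivariant_set1 _ _ zw).
apply: le_measure; rewrite ?inE; [exact: measurable_set1_rV| |].
  by apply: measurableD; [exact: measurable_cube|exact: measurable_set1_rV].
by move=> _ ->; split => //=; apply/eqP; rewrite subr_eq0.
Qed.

(** The punctured cubes decrease to the empty set and the first lies in a compact box, so continuity
    from above applies. *)
Lemma punctured_cube_small (m : {measure set V -> \bar R}) p :
  (forall K, compact K -> m K < +oo) ->
  exists N, m ([set y | cube N (y - p)%R] `\ p) < eps%:E.
Proof.
move=> mK; pose F N := [set y | cube N (y - p)%R] `\ p.
have mF N : measurable (F N).
  apply: measurableD; last exact: measurable_set1_rV.
  exact: (measurable_preimageT (measurable_translate (- p)%R) (measurable_cube N)).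
have F0 : \bigcap_N F N = set0.
  rewrite -subset0 => x xF; have [_ x0] := xF 0%N I; apply: x0 => /=.
  apply/rowP => i; apply/eqP; rewrite -subr_eq0 -normr_le0 leNgt; apply/negP => xi.
  have [N] := ltr_add_invr xi; rewrite add0r ltNge => /negP; apply.
  by have [/(_ i) /ltW] := xF N I; rewrite !mxE.
have cF : (m \o F) @ \oo --> m (\bigcap_N F N).
  apply: nonincreasing_cvg_mu => //.
  - have mB : m (closed_box (p - const_mx 1)%R (p + const_mx 1)%R) < +oo.
      by apply: mK; exact: compact_closed_box.
    apply: le_lt_trans mB.
    apply: le_measure; rewrite ?inE//; first exact: measurable_closed_box.
    move=> x [+ _] i => /(_ i); rewrite !mxE invr1 ltr_norml.
    by move=> /andP[? ?]; apply/andP; split; lra.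
  - exact: bigcapT_measurable.
  - move=> a b ab; apply/subsetPset => x [xb x0]; split => // i.
    by apply: lt_le_trans (xb i) _; rewrite lef_pV2 ?posrE// ler_nat.
rewrite F0 measure0 in cF.
apply: contrapT => h; suff : eps%:E <= 0 by rewrite lee_fin leNgt eps0.
rewrite -(cvg_lim _ cF)//; apply: lime_ge; first by apply/cvg_ex; eexists; exact: cF.
by apply: nearW => N; rewrite leNgt; apply/negP => hN; apply: h; exists N.
Qed.

Lemma visit_exists w p : equivariant_at zeta w ->
  (forall K, compact K -> zeta w K < +oo) ->
  eps%:E <= zeta w [set p] -> exists N, visit N (theta p w).
Proof.
move=> zw zK pe; have [N hN] := punctured_cube_small p zK; exists N; split.
  by rewrite (equivariant_set1 _ _ zw) add0r.
rewrite zw; last by apply: measurableD; [exact: measurable_cube|exact: measurable_set1_rV].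
rewrite [X in zeta w X](_ : _ = [set y | cube N (y - p)%R] `\ p)//.
apply/seteqP; split => y [cy yp]; split => //.
  by move=> yp'; apply: yp; rewrite /= yp' subrr.
by move=> /eqP; rewrite subr_eq0 => /eqP.
Qed.

(* The visited point [p] whose cell [p + grid N i] contains the origin; it is unique, so its
   coordinates are suprema of the rationals [q] for which [p] lies beyond [q]. *)
Definition anchored N i : set Omega :=
  [set w | 0 < zeta w [set p | visit N (theta p w) /\ grid N i (- p)%R]].

Definition anchor N i w : V := \row_k dedekind (fun q : rat =>
  0 < zeta w [set p | [/\ visit N (theta p w), grid N i (- p)%R & (ratr q < p ord0 k)%R]]).

Let mvisit2 N i : measurable [set x : Omega * V | visit N (theta x.2 x.1) /\ grid N i (- x.2)%R].
Proof.
apply: measurableI.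
  apply: (measurable_preimageT _ (measurable_visit N)); apply: measurable_flow2 => //.
apply: (measurable_preimageT _ (measurable_grid N i)); exact: measurable_funN_rV.
Qed.

Lemma measurable_anchored N i : measurable (anchored N i).
Proof.
rewrite -[X in measurable X]setTI; apply: emeasurable_fun_o_infty; first by [].
exact: (measurable_kernel_section mzeta fzeta (mvisit2 N i)).
Qed.

Lemma measurable_anchor N i : measurable_fun setT (anchor N i).
Proof.
apply: measurable_fun_rV => k; under eq_fun do rewrite mxE.
apply: (@measurable_dedekind R _ _ (fun q : rat => [set w | 0 < zeta w [set p |
   [/\ visit N (theta p w), grid N i (- p)%R & (ratr q < p ord0 k)%R]]])) => q.
rewrite -[X in measurable X]setTI; apply: emeasurable_fun_o_infty; first by [].
have mE : measurable ([set x : Omega * V | visit N (theta x.2 x.1) /\ grid N i (- x.2)%R]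
    `&` [set x : Omega * V | (ratr q < x.2 ord0 k)%R]).
  apply: measurableI => //; apply: measurable_set_lt => //.
  exact: (measurableT_comp (measurable_coord k) measurable_snd).
rewrite [X in measurable_fun _ X](_ : _ = fun w => zeta w [set p |
   ([set x : Omega * V | visit N (theta x.2 x.1) /\ grid N i (- x.2)%R]
    `&` [set x : Omega * V | (ratr q < x.2 ord0 k)%R]) (w, p)]).
  by have := measurable_kernel_section mzeta fzeta mE.
apply/funext => w; congr (zeta w _); apply/seteqP; split => p /=; first by case.
by case=> [[]].
Qed.

Lemma anchor_unique N i w p q : equivariant_at zeta w ->
  visit N (theta p w) -> grid N i (- p)%R ->
  visit N (theta q w) -> grid N i (- q)%R -> p = q.
Proof.
move=> zw vp gp vq gq; apply: (visit_unique zw vp vq).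
by have := grid_cube gp gq; rewrite opprK addrC.
Qed.

(** The set measured by [zeta] is [[set p]] or empty, and a visited [p] carries mass at least [eps];
    positivity of the mass thus decides exactly whether [p] exists, or lies beyond [q]. *)
Lemma anchorP N i w p : equivariant_at zeta w ->
  visit N (theta p w) -> grid N i (- p)%R -> anchored N i w /\ anchor N i w = p.
Proof.
move=> zw vp gp.
have zp : 0 < zeta w [set p].
  case: vp => + _; rewrite (equivariant_set1 _ _ zw) add0r; apply: lt_le_trans.
  by rewrite lte_fin.
split.
  rewrite /anchored/= [X in zeta w X](_ : _ = [set p])//.
  by apply/seteqP; split => [q [vq gq]|_ ->//]; exact: (anchor_unique zw vq gq vp gp).
apply/rowP => k; rewrite mxE; apply: dedekindE => q.
  move=> qp; rewrite [X in zeta w X](_ : _ = [set p])//.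
  apply/seteqP; split => [r [vr gr _]|_ ->//]; exact: (anchor_unique zw vr gr vp gp).
move=> h; rewrite leNgt; apply/negP => pq; move: h.
rewrite [X in zeta w X](_ : _ = set0) ?measure0 ?ltxx// -subset0.
move=> r [vr gr qr]; move: qr; rewrite (anchor_unique zw vr gr vp gp).
by rewrite ltNge (ltW pq).
Qed.

Lemma anchoredP N i w : anchored N i w ->
  exists p, visit N (theta p w) /\ grid N i (- p)%R.
Proof.
move=> aw; apply: contrapT => h; move: aw; rewrite /anchored/=.
rewrite [X in zeta w X](_ : _ = set0) ?measure0 ?ltxx// -subset0 => p vp.
by apply: h; exists p.
Qed.

End visits.

(** * One matching step *)

Section step.
Local Open Scope ereal_scope.
Context {R : realType} {n : nat} {dO : measure_display} {Omega : measurableType dO}.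
Local Notation V := 'rV[R]_n.
Variable theta : V -> Omega -> Omega.
Hypothesis flow : measurable_flow theta.

Let flow0 w : theta 0%R w = w. Proof. by have [_ -> _] := flow. Qed.

Lemma equivariant_integral (k : Omega -> {measure set V -> \bar R}) w p A (h : V -> \bar R) :
  equivariant_at theta k w -> measurable A -> measurable_fun setT h -> (forall y, 0 <= h y) ->
  \int[k (theta p w)]_(y in A) h y = \int[k w]_(y in [set y | A (y - p)%R]) h (y - p)%R.
Proof.
move=> kw mA mh h0.
transitivity (\int[image_measure (k w) (measurable_translate (- p)%R)]_(y in A) h y).
  by apply: eq_measure_integral => B mB _; rewrite kw.
rewrite ge0_integral_pushforward//; first exact: measurable_translate.
exact: measurable_funTS.
Qed.

Variables xi eta zeta : Omega -> {measure set V -> \bar R}.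
Hypothesis mxi : forall A, measurable A -> measurable_fun setT (xi ^~ A).
Hypothesis meta : forall A, measurable A -> measurable_fun setT (eta ^~ A).
Hypothesis mzeta : forall A, measurable A -> measurable_fun setT (zeta ^~ A).
Hypothesis fxi : forall w, locally_finite (xi w).
Hypothesis feta : forall w, locally_finite (eta w).
Hypothesis fzeta : forall w, locally_finite (zeta w).
Variable eps : R.
Hypothesis eps0 : (0 < eps)%R.

Variables (N : nat) (i j : 'rV[int]_n) (U : set Omega) (f : Omega -> R).

(* Random subsets and densities are read off at the origin: [U] stands for the set of sources
   [s] with [theta s w] in [U] that are still free, and [f (theta y w)] for the fraction of
   [eta] at [y] not yet served. A step sends, for each visit [p], mass of [xi] from
   [p + grid N i] to [p + grid N j]; [src] and [tgt] describe it for a visit at the origin. *)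
Definition src w : set V -> \bar R :=
  fun A => xi w (A `&` [set z | grid N i z /\ U (theta z w)]).

Definition tgt w : set V -> \bar R :=
  fun A => \int[eta w]_(y in A) (f (theta y w) * \1_(grid N j) y)%:E.

(* Equals [0] if there is no target mass, as [x / 0 = 0]. *)
Definition ratio w : R :=
  (Num.min (fine (src w setT)) (fine (tgt w setT)) / fine (tgt w setT))%R.

(** The transport is computed in the realisation recentred at the anchor [p], where the original
    origin sits at [- p]. *)
Definition used : set Omega := [set w | [/\ U w, anchored theta zeta eps N i w &
  let p := anchor theta zeta eps N i w in
  transported (src (theta p w)) (tgt (theta p w)) (ratio (theta p w)) (- p)%R]].

Definition disp w : V :=
  let p := anchor theta zeta eps N i w in
  (p + transport (src (theta p w)) (tgt (theta p w)) (ratio (theta p w)) (- p))%R.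

(** Here the origin is a target, so its anchor is found through cell [j]. The whole target cell is
    scaled by one factor, which serves atoms and diffuse mass alike. *)
Definition newf w : R :=
  if w \in anchored theta zeta eps N j
  then (f w * (1 - ratio (theta (anchor theta zeta eps N j w) w)))%R else f w.

Hypotheses (mU : measurable U) (mf : measurable_fun setT f).
Hypothesis f0 : forall w, (0 <= f w)%R.
Hypothesis f1 : forall w, (f w <= 1)%R.

Let mtheta w : measurable_fun setT (fun z => theta z w).
Proof. by apply: measurable_flow2. Qed.

Let mS w : measurable [set z | grid N i z /\ U (theta z w)].
Proof.
apply: measurableI; first exact: measurable_grid.
exact: (measurable_preimageT (mtheta w)).
Qed.

Let src_m w : {measure set V -> \bar R} := mrestr (xi w) (mS w).

Let g w y : R := (f (theta y w) * \1_(grid N j) y)%R.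
Let g0 w y : (0 <= g w y)%R. Proof. by rewrite /g mulr_ge0. Qed.
Let mg w : measurable_fun setT (g w).
Proof.
apply: measurable_funM; first exact: (measurableT_comp mf (mtheta w)).
by apply: measurable_indic; exact: measurable_grid.
Qed.

Let tgt_m w : {measure set V -> \bar R} := mdensity (eta w) (g0 w) (mg w).

Let src_mE w : src w = src_m w :> (set V -> \bar R). Proof. by []. Qed.
Let tgt_mE w : tgt w = tgt_m w :> (set V -> \bar R). Proof. by []. Qed.

Let grid_lty (k : Omega -> {measure set V -> \bar R}) w M l :
  locally_finite (k w) -> k w (grid M l) < +oo.
Proof.
move=> fk; have [l' ll] := @grid_sub R n M l; apply: le_lt_trans (fk l').
by apply: le_measure; rewrite ?inE//; exact: measurable_grid.
Qed.

Let src_lty w : src_m w setT < +oo.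
Proof.
apply: le_lt_trans (grid_lty N i (fxi w)); rewrite /src_m/= /mrestr setTI.
by apply: le_measure; rewrite ?inE//; [exact: measurable_grid|move=> z []].
Qed.

Let tgt_lty w : tgt_m w setT < +oo.
Proof.
apply: le_lt_trans (grid_lty N j (feta w)).
rewrite /tgt_m/= /mdensity -[X in _ <= eta w X]setIT -integral_indic//; last exact: measurable_grid.
apply: ge0_le_integral => //.
- by move=> y _; rewrite lee_fin g0.
- by apply/measurable_EFinP; exact: mg.
- by apply/measurable_EFinP; apply: measurable_indic; exact: measurable_grid.
- by move=> y _; rewrite lee_fin /g ler_piMl// indicE.
Qed.

Lemma ratio_ge0 w : (0 <= ratio w)%R.
Proof. by rewrite /ratio divr_ge0// ?le_min ?fine_ge0// ?tgt_mE ?src_mE. Qed.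

Lemma ratio_le1 w : (ratio w <= 1)%R.
Proof.
have : (0 <= fine (tgt_m w setT))%R by exact: fine_ge0.
rewrite /ratio tgt_mE le_eqVlt => /orP[/eqP <-|h]; first by rewrite invr0 mulr0.
by rewrite ler_pdivrMr// mul1r ge_min lexx orbT.
Qed.

Lemma ratioM w : (ratio w * fine (tgt w setT) =
  Num.min (fine (src w setT)) (fine (tgt w setT)))%R.
Proof.
rewrite /ratio; have [t0|t0] := eqVneq (fine (tgt w setT)) 0%R; last by rewrite divfK.
by rewrite t0 mulr0; apply/esym/min_idPr; rewrite src_mE fine_ge0.
Qed.

Let ratio_le w : (ratio w * fine (tgt_m w setT) <= fine (src_m w setT))%R.
Proof. by rewrite -tgt_mE -src_mE ratioM ge_min lexx. Qed.

Section measurability.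
Context d (T : measurableType d) (a : T -> Omega) (ma : measurable_fun setT a).

Lemma measurable_src (E : set (T * V)) : measurable E ->
  measurable_fun setT (fun x => src (a x) [set z | E (x, z)]).
Proof.
move=> mE; pose F := E `&` [set x : T * V | grid N i x.2 /\ U (theta x.2 (a x.1))].
have mF : measurable F.
  apply: measurableI => //; apply: measurableI.
    exact: (measurable_preimageT measurable_snd (measurable_grid N i)).
  apply: (measurable_preimageT _ mU); apply: measurable_flow2 => //.
  exact: (measurableT_comp ma measurable_fst).
apply: (@measurable_kernel_section R n _ T (xi \o a) _ _ F) => //.
- by move=> A mA; exact: (measurableT_comp (mxi mA) ma).
- by move=> x; exact: fxi.
Qed.

Lemma measurable_tgt (E : set (T * V)) : measurable E ->
  measurable_fun setT (fun x => tgt (a x) [set z | E (x, z)]).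
Proof.
move=> mE.
rewrite [X in measurable_fun _ X](_ : _ = fun x => \int[eta (a x)]_y
   (f (theta y (a x)) * \1_(grid N j) y * \1_E (x, y))%:E).
  apply: (@measurable_kernel_integral R n _ T (eta \o a) _ _ (fun x =>
    (f (theta x.2 (a x.1)) * \1_(grid N j) x.2 * \1_E x)%:E)).
  - by move=> A mA; exact: (measurableT_comp (meta mA) ma).
  - by move=> x; exact: feta.
  - by move=> x; rewrite lee_fin !mulr_ge0.
  apply/measurable_EFinP; apply: measurable_funM; last exact: measurable_indic.
  apply: measurable_funM.
    apply: (measurableT_comp mf); apply: measurable_flow2 => //.
    exact: (measurableT_comp ma measurable_fst).
  apply: (measurableT_comp _ measurable_snd).
  by apply: measurable_indic; exact: measurable_grid.
apply/funext => x; rewrite /tgt integral_mkcond; apply: eq_integral => y _.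
by rewrite epatch_indic/= -EFinM !indicE; congr (_ * (nat_of_bool _)%:R)%:E; apply/idP/idP; rewrite !inE.
Qed.

Lemma measurable_fine_src_T : measurable_fun setT (fun x => fine (src (a x) setT)).
Proof.
apply: measurableT_comp => //.
rewrite [X in measurable_fun _ X](_ : _ = (fun x => src (a x) [set z | [set: T * V] (x, z)])).
  exact: measurable_src.
by apply/funext => x; congr (src _ _); apply/seteqP.
Qed.

Lemma measurable_fine_tgt_T : measurable_fun setT (fun x => fine (tgt (a x) setT)).
Proof.
apply: measurableT_comp => //.
rewrite [X in measurable_fun _ X](_ : _ = (fun x => tgt (a x) [set z | [set: T * V] (x, z)])).
  exact: measurable_tgt.
by apply/funext => x; congr (tgt _ _); apply/seteqP.
Qed.

Lemma measurable_ratio : measurable_fun setT (fun x => ratio (a x)).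
Proof.
apply: measurable_funM.
  apply: measurable_minr; [exact: measurable_fine_src_T|exact: measurable_fine_tgt_T].
apply: measurable_fun_inv_ge0; last exact: measurable_fine_tgt_T.
by move=> x; rewrite tgt_mE fine_ge0.
Qed.

Let mle (b : T -> R) : measurable_fun setT b ->
  measurable [set x : T * V | (encode x.2 <= b x.1)%R].
Proof.
move=> mb; apply: measurable_set_le.
  exact: (measurableT_comp measurable_encode measurable_snd).
exact: (measurableT_comp mb measurable_fst).
Qed.

Lemma measurable_cumul_src (b : T -> R) : measurable_fun setT b ->
  measurable_fun setT (fun x => cumul (src (a x)) (b x)).
Proof. by move=> mb; apply: measurableT_comp => //; exact: measurable_src (mle mb). Qed.

Lemma measurable_cumul_tgt (b : T -> R) : measurable_fun setT b ->
  measurable_fun setT (fun x => cumul (tgt (a x)) (b x)).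
Proof. by move=> mb; apply: measurableT_comp => //; exact: measurable_tgt (mle mb). Qed.

Lemma measurable_transport (b : T -> V) : measurable_fun setT b ->
  measurable_fun setT (fun x => transport (src (a x)) (tgt (a x)) (ratio (a x)) (b x)).
Proof.
move=> mb; apply: (measurableT_comp measurable_decode).
apply: (@measurable_dedekind R _ _ (fun q => [set x |
  (ratio (a x) * cumul (tgt (a x)) (ratr q) < cumul (src (a x)) (encode (b x)))%R])) => q.
apply: measurable_set_lt.
  by apply: measurable_funM; [exact: measurable_ratio|exact: measurable_cumul_tgt].
by apply: measurable_cumul_src; exact: (measurableT_comp measurable_encode mb).
Qed.

Lemma measurable_transported_set (b : T -> V) : measurable_fun setT b ->
  measurable [set x | transported (src (a x)) (tgt (a x)) (ratio (a x)) (b x)].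
Proof.
move=> mb; apply: measurable_set_le.
  by apply: measurable_cumul_src; exact: (measurableT_comp measurable_encode mb).
by apply: measurable_funM; [exact: measurable_ratio|exact: measurable_fine_tgt_T].
Qed.

End measurability.

Let mshift l : measurable_fun setT (fun w => theta (anchor theta zeta eps N l w) w).
Proof. by apply: measurable_flow2 => //; exact: measurable_anchor. Qed.

Lemma measurable_used : measurable used.
Proof.
rewrite (_ : used = U `&` (anchored theta zeta eps N i `&`
  [set w | let p := anchor theta zeta eps N i w in
   transported (src (theta p w)) (tgt (theta p w)) (ratio (theta p w)) (- p)%R])); last first.
  by apply/seteqP; split => w; [case|case=> ? []].
apply: measurableI => //; apply: measurableI; first exact: measurable_anchored.
apply: measurable_transported_set; first exact: mshift.
by apply: measurable_funN_rV; exact: measurable_anchor.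
Qed.

Lemma measurable_disp : measurable_fun setT disp.
Proof.
apply: measurable_funD_rV; first exact: measurable_anchor.
apply: measurable_transport; first exact: mshift.
by apply: measurable_funN_rV; exact: measurable_anchor.
Qed.

Lemma measurable_newf : measurable_fun setT newf.
Proof.
apply: measurable_fun_if_set => //; first exact: measurable_anchored.
apply: measurable_funM => //; apply: measurable_funB => //.
by apply: measurable_ratio; exact: mshift.
Qed.

Lemma newf_ge0 w : (0 <= newf w)%R.
Proof. by rewrite /newf; case: ifPn => // _; rewrite mulr_ge0// subr_ge0 ratio_le1. Qed.

Lemma newf_le w : (newf w <= f w)%R.
Proof. by rewrite /newf; case: ifPn => // _; rewrite ler_piMr// gerBl ratio_ge0. Qed.

Lemma equivariant_flow (k : Omega -> {measure set V -> \bar R}) w x :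
  equivariant_at theta k w -> equivariant_at theta k (theta x w).
Proof.
move=> kw y C mC; rewrite (flowD flow) !kw//; last exact: measurable_preimage_translate.
by congr (k w _); apply/seteqP; split => z /=; rewrite opprD addrA addrAC.
Qed.

Section at_good_point.
Variable w : Omega.
Hypotheses (xw : equivariant_at theta xi w) (ew : equivariant_at theta eta w)
  (zw : equivariant_at theta zeta w).
Hypothesis dw : forall x, xi w [set x] = 0.

(** Seen from [s], the visit [p] is at [p - s]. This turns definitions read off at the origin into
    statements about the cells [p + grid N l] of a fixed realisation. *)
Let anchor_at l p s : visit zeta eps N (theta p w) -> grid N l (s - p)%R ->
  anchored theta zeta eps N l (theta s w) /\ anchor theta zeta eps N l (theta s w) = (p - s)%R.
Proof.
move=> vp gp; apply: anchorP => //; first exact: equivariant_flow.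
  by rewrite (flowD flow) subrK.
by rewrite opprB.
Qed.

Lemma used_at p s : visit zeta eps N (theta p w) -> grid N i (s - p)%R ->
  used (theta s w) <->
  U (theta s w) /\ transported (src (theta p w)) (tgt (theta p w)) (ratio (theta p w)) (s - p)%R.
Proof.
move=> vp gp; have [a1 a2] := anchor_at vp gp.
rewrite /used/= a2 (flowD flow) subrK opprB; split; first by case.
by case.
Qed.

Lemma disp_at p s : visit zeta eps N (theta p w) -> grid N i (s - p)%R ->
  (s + disp (theta s w))%R =
  (p + transport (src (theta p w)) (tgt (theta p w)) (ratio (theta p w)) (s - p))%R.
Proof.
move=> vp gp; have [a1 a2] := anchor_at vp gp.
by rewrite /disp/= a2 (flowD flow) subrK opprB addrA (addrC s) subrK.
Qed.

Lemma newf_at p y : visit zeta eps N (theta p w) -> grid N j (y - p)%R ->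
  newf (theta y w) = (f (theta y w) * (1 - ratio (theta p w)))%R.
Proof.
move=> vp gp; have [a1 a2] := anchor_at vp gp.
by rewrite /newf (mem_set a1) a2 (flowD flow) subrK.
Qed.

Lemma newf_away y : (forall p, visit zeta eps N (theta p w) -> ~ grid N j (y - p)%R) ->
  newf (theta y w) = f (theta y w).
Proof.
move=> h; rewrite /newf; case: ifPn => // /set_mem/anchoredP[p []].
rewrite (flowD flow) => vp gp; exfalso; apply: (h _ vp).
by rewrite opprD addrCA subrr addr0.
Qed.

Lemma used_near s : used (theta s w) ->
  exists p, visit zeta eps N (theta p w) /\ grid N i (s - p)%R.
Proof.
move=> [_ /anchoredP[p []]]; rewrite (flowD flow) => vp gp _.
by exists (p + s)%R; split => //; rewrite opprD addrCA subrr addr0.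
Qed.

Let diffuse_at p x : xi (theta p w) [set x] = 0.
Proof. by rewrite (equivariant_set1 _ _ xw). Qed.

(** Equivariance carries [transportE] from [theta p w] back to [w]; on the target cell of [p],
    [f - newf] is [f] times the ratio. *)
Lemma point_balance p C : visit zeta eps N (theta p w) -> measurable C ->
  xi w [set s | [/\ grid N i (s - p)%R, used (theta s w) & C (s + disp (theta s w))%R]] =
  \int[eta w]_(y in C `&` [set y | grid N j (y - p)%R])
     (f (theta y w) - newf (theta y w))%:E.
Proof.
move=> vp mC; set w' := theta p w.
pose C' := [set y | C (p + y)%R].
have mC' : measurable C'.
  rewrite (_ : C' = (fun y => y + p)%R @^-1` C); first exact: measurable_preimage_translate.
  by apply/seteqP; split => y; rewrite /C'/= addrC.
have E : src_m w' (transported (src_m w') (tgt_m w') (ratio w') `&`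
    transport (src_m w') (tgt_m w') (ratio w') @^-1` C') = (ratio w')%:E * tgt_m w' C'.
  apply: (transportE (src_lty w') (tgt_lty w') _ (ratio_ge0 w') (ratio_le w') mC').
  move=> x; apply/eqP; rewrite -measure_le0 -(diffuse_at p x).
  apply: le_measure; rewrite ?inE; [|exact: measurable_set1_rV|by move=> ? []].
  by apply: measurableI => //; exact: measurable_set1_rV.
transitivity (src_m w' (transported (src_m w') (tgt_m w') (ratio w') `&`
    transport (src_m w') (tgt_m w') (ratio w') @^-1` C')).
  rewrite /src_m/= /mrestr xw; last first.
    apply: measurableI; last exact: (mS w').
    apply: measurableI; first exact: (measurable_transported (tgt_m w') (src_lty w')).
    apply: measurable_preimageT => //.
    apply: (measurableT_comp measurable_decode).
    apply: (measurableT_comp (measurable_quantile (tgt_m w') (ratio w'))).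
    exact: (measurableT_comp (measurable_cumul (src_lty w')) measurable_encode).
  congr (xi w _); apply/seteqP; split => s /=.
    move=> [gs /(used_at vp gs)[Us ts]]; rewrite (disp_at vp gs) => Cs.
    by split => //; split => //; rewrite /w' (flowD flow) subrK.
  move=> [[ts Cs] [gs]]; rewrite /w' (flowD flow) subrK => Us.
  by split => //; [exact/(used_at vp gs)|rewrite (disp_at vp gs)].
rewrite E -tgt_mE /tgt -(ge0_integralZl_EFin _ mC'); last 3 first.
- by move=> y _; rewrite lee_fin; exact: (g0 w').
- by apply/measurable_EFinP; apply: measurable_funTS; exact: (mg w').
- exact: ratio_ge0.
rewrite equivariant_integral//; last 2 first.
- by apply/measurable_EFinP; apply: measurable_funM => //; exact: (mg w').
- by move=> y; rewrite -EFinM lee_fin mulr_ge0 ?ratio_ge0//; exact: (g0 w').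
rewrite integral_mkcond [RHS]integral_mkcond; apply: eq_integral => y _.
rewrite !patchE/= {1}/w' (flowD flow) subrK indicE.
have -> : (y \in [set y0 | C' (y0 - p)%R]) = (y \in C).
  have e : (p + (y - p) = y)%R by rewrite addrC subrK.
  by apply/idP/idP => /set_mem; rewrite /C'/= ?e => h; apply/mem_set; rewrite /= ?e.
have [gy|gy] := pselect (grid N j (y - p)%R); last first.
  have -> : (y \in C `&` [set y0 | grid N j (y0 - p)%R]) = false.
    by apply/negP => /set_mem[].
  by rewrite (memNset gy) mulr0 mule0; case: ifPn.
have yC : (y \in C `&` [set y0 | grid N j (y0 - p)%R]) = (y \in C).
  apply/idP/idP => /set_mem; first by case=> Cy _; exact/mem_set.
  by move=> Cy; exact: (mem_set (conj Cy gy)).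
have -> : ((y - p)%R \in grid N j) = true by exact/mem_set.
rewrite mulr1 yC; case: ifPn => // _.
by rewrite (newf_at vp gy) -EFinM; congr EFin; rewrite /w'; ring.
Qed.

Lemma visit_code p q : visit zeta eps N (theta p w) -> visit zeta eps N (theta q w) ->
  floor_rV N p = floor_rV N q -> p = q.
Proof.
move=> vp vq pq; apply: (visit_unique zw vp vq).
by apply: (@grid_cube R n N (floor_rV N p)); rewrite /grid/=.
Qed.

(** Points sorted by their visit, which is numbered by its own grid cell. A cell contains at most
    one visit, so [near l h] is a single translated cell or empty. *)
Let near l (h : nat) : set V := [set y | exists p,
  [/\ visit zeta eps N (theta p w), pickle (floor_rV N p) = h & grid N l (y - p)%R]].

Let near_point l p : visit zeta eps N (theta p w) ->
  near l (pickle (floor_rV N p)) = [set y | grid N l (y - p)%R].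
Proof.
move=> vp; apply/seteqP; split => [y [q [vq pq gy]]|y gy]; last by exists p.
by rewrite /= (visit_code vp vq)//; apply: (pcan_inj pickleK).
Qed.

Let near_empty l h : ~ (exists2 p, visit zeta eps N (theta p w) & pickle (floor_rV N p) = h) ->
  near l h = set0.
Proof. by move=> hh; rewrite -subset0 => y [p [vp ph _]]; apply: hh; exists p. Qed.

Let measurable_near l h : measurable (near l h).
Proof.
have [[p vp <-]|hh] := pselect (exists2 p, visit zeta eps N (theta p w) & pickle (floor_rV N p) = h).
  rewrite near_point//.
  rewrite (_ : [set y | _] = (fun y => y + - p)%R @^-1` (grid N l))//.
  by apply: measurable_preimage_translate; exact: measurable_grid.
by rewrite near_empty.
Qed.

Let trivIset_near l : trivIset setT (near l).
Proof.
move=> a b _ _ [y [[p [vp <- gp]] [q [vq <- gq]]]].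
suff -> : p = q by [].
apply: (visit_unique zw vp vq).
by have := grid_cube gp gq; rewrite opprB addrC addrA subrK.
Qed.

Lemma step_balance C : measurable C ->
  xi w [set s | used (theta s w) /\ C (s + disp (theta s w))%R] =
  \int[eta w]_(y in C) (f (theta y w) - newf (theta y w))%:E.
Proof.
move=> mC.
have mL : measurable [set s | used (theta s w) /\ C (s + disp (theta s w))%R].
  apply: measurableI.
    by apply: (measurable_preimageT _ measurable_used).
  apply: (measurable_preimageT _ mC); apply: measurable_funD_rV => //.
  exact: (measurableT_comp measurable_disp (mtheta w)).
have mdf : measurable_fun setT (fun y => (f (theta y w) - newf (theta y w))%:E).
  apply/measurable_EFinP; apply: measurable_funB.
    exact: (measurableT_comp mf (mtheta w)).
  exact: (measurableT_comp measurable_newf (mtheta w)).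
have df0 y : 0 <= (f (theta y w) - newf (theta y w))%:E.
  by rewrite lee_fin subr_ge0 newf_le.
rewrite [LHS](_ : _ = xi w (\bigcup_h ([set s | used (theta s w) /\ C (s + disp (theta s w))%R] `&` near i h))); last first.
  congr (xi w _); rewrite -setI_bigcupr; apply/seteqP; split; last by move=> s [].
  move=> s us; split => //; have [p [vp gp]] := used_near us.1.
  by exists (pickle (floor_rV N p)) => //; exists p.
rewrite measure_semi_bigcup//; last 3 first.
- by move=> h; exact: measurableI.
- exact/trivIset_setIl/trivIset_near.
- by apply: bigcupT_measurable => h; exact: measurableI.
(* Outside all target cells [newf] equals [f], so the integrand vanishes there. *)
rewrite [RHS](_ : _ = \int[eta w]_(y in \bigcup_h (C `&` near j h))
   (f (theta y w) - newf (theta y w))%:E); last first.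
  rewrite integral_mkcond [RHS]integral_mkcond; apply: eq_integral => y _.
  rewrite !patchE -setI_bigcupr in_setI; case: ifPn => //= yC.
  case: ifPn => // /negP yN; rewrite newf_away ?subrr// => p vp gp; apply: yN.
  by rewrite inE; exists (pickle (floor_rV N p)) => //; exists p.
rewrite ge0_integral_bigcup//; last 3 first.
- by move=> h; exact: measurableI.
- exact: measurable_funTS.
- exact/trivIset_setIl/trivIset_near.
apply: eq_eseriesr => h _.
have [[p vp <-]|hh] := pselect (exists2 p, visit zeta eps N (theta p w) & pickle (floor_rV N p) = h).
  rewrite !near_point// -point_balance//; congr (xi w _).
  by apply/seteqP; split => s /=; [case=> [[]]|case].
by rewrite !near_empty// !setI0 measure0 integral_set0.
Qed.

(** The smaller mass is moved entirely: either the threshold of [transported] is the whole source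
    mass, or the ratio is 1 and [newf] vanishes on the target cell. *)
Lemma step_exhaust : visit zeta eps N w ->
  xi w [set z | grid N i z /\ (U `\` used) (theta z w)] = 0 \/
  \int[eta w]_(y in grid N j) (newf (theta y w))%:E = 0.
Proof.
move=> vw; have v0 : visit zeta eps N (theta 0%R w) by rewrite flow0.
have [ab|ba] := leP (fine (src w setT)) (fine (tgt w setT)); [left|right].
  rewrite [X in xi w X](_ : _ = set0) ?measure0// -subset0 => z [gz [Uz]]; apply.
  rewrite -[z]subr0 in gz; apply/(used_at v0 gz); split => //.
  rewrite flow0 /transported/= ratioM (min_idPl ab).
  exact: (cumul_leT (src_lty w)).
(* Without target mass the ratio is 0, not 1, but then [f], and with it [newf], already has integral
   0. *)
have [b0|b0] := eqVneq (fine (tgt w setT)) 0%R.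
  apply/eqP; rewrite eq_le; apply/andP; split; last first.
    by apply: integral_ge0 => y _; rewrite lee_fin newf_ge0.
  have <- : tgt w setT = 0 by rewrite -[LHS]fineK ?b0// ge0_fin_numE ?tgt_lty// integral_ge0// => y _; rewrite lee_fin; exact: (g0 w).
  rewrite /tgt integral_mkcond; apply: ge0_le_integral => //.
  - by move=> y _; apply: erestrict_ge0 => z _; rewrite lee_fin newf_ge0.
  - apply/(measurable_restrictT _ (measurable_grid N j)); apply: measurable_funTS.
    by apply/measurable_EFinP; exact: (measurableT_comp measurable_newf (mtheta w)).
  - by apply/measurable_EFinP; exact: (mg w).
  move=> y _; rewrite patchE indicE; case: ifPn => // _; last by rewrite lee_fin mulr0.
  by rewrite mulr1 lee_fin newf_le.
rewrite (eq_integral (cst 0)) ?integral0// => y /set_mem gy.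
rewrite -[y]subr0 in gy; rewrite (newf_at v0 gy) flow0.
by rewrite /ratio (min_idPr (ltW ba)) divff// subrr mulr0.
Qed.

End at_good_point.

End step.

(** * The infinite sequence of steps *)

Section matching.
Local Open Scope ereal_scope.
Context {R : realType} {n : nat} {dO : measure_display} {Omega : measurableType dO}.
Local Notation V := 'rV[R]_n.
Variable theta : V -> Omega -> Omega.
Hypothesis flow : measurable_flow theta.

Variables xi eta zeta : Omega -> {measure set V -> \bar R}.
Hypothesis mxi : forall A, measurable A -> measurable_fun setT (xi ^~ A).
Hypothesis meta : forall A, measurable A -> measurable_fun setT (eta ^~ A).
Hypothesis mzeta : forall A, measurable A -> measurable_fun setT (zeta ^~ A).
Hypothesis fxi : forall w, locally_finite (xi w).
Hypothesis feta : forall w, locally_finite (eta w).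
Hypothesis fzeta : forall w, locally_finite (zeta w).
Variable eps : R.
Hypothesis eps0 : (0 < eps)%R.

(** Every triple [(N, i, j)] occurs, at its own code. Other numbers repeat a default move,
    harmlessly, since a step can start from any state. *)
Definition move (k : nat) : nat * 'rV[int]_n * 'rV[int]_n :=
  odflt (0%N, 0%R, 0%R) (unpickle k).

Fixpoint state (k : nat) : set Omega * (Omega -> R) :=
  if k is k'.+1 then
    let U := (state k').1 in let f := (state k').2 in
    let N := (move k').1.1 in let i := (move k').1.2 in let j := (move k').2 in
    (U `\` used theta xi eta zeta eps N i j U f, newf theta xi eta zeta eps N i j U f)
  else (setT, cst 1%R).

Definition used_ k := used theta xi eta zeta eps
  (move k).1.1 (move k).1.2 (move k).2 (state k).1 (state k).2.

Definition disp_ k := disp theta xi eta zeta eps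
  (move k).1.1 (move k).1.2 (move k).2 (state k).1 (state k).2.

Lemma stateS k : state k.+1 = ((state k).1 `\` used_ k,
  newf theta xi eta zeta eps (move k).1.1 (move k).1.2 (move k).2 (state k).1 (state k).2).
Proof. by []. Qed.

Lemma state_inv k : [/\ measurable (state k).1, measurable_fun setT (state k).2,
  forall w, (0 <= (state k).2 w)%R & forall w, ((state k).2 w <= 1)%R].
Proof.
elim: k => [|k [mU mf f0 f1]].
  by split => //=; exact: measurable_cst.
rewrite stateS; split => /=.
- by apply: measurableD => //; exact: measurable_used.
- exact: measurable_newf.
- by move=> w; apply: newf_ge0.
- by move=> w; apply: le_trans (f1 w); apply: newf_le.
Qed.

Lemma measurable_used_ k : measurable (used_ k).
Proof. by have [mU mf f0 f1] := state_inv k; exact: measurable_used. Qed.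

Lemma measurable_disp_ k : measurable_fun setT (disp_ k).
Proof. by have [mU mf f0 f1] := state_inv k; exact: measurable_disp. Qed.

Lemma state2_le k w : ((state k.+1).2 w <= (state k).2 w)%R.
Proof. by have [mU mf f0 f1] := state_inv k; rewrite stateS; exact: newf_le. Qed.

Lemma state1_used k l w : (k <= l)%N -> (state l).1 w <-> (state k).1 w /\
  forall h, (k <= h < l)%N -> ~ used_ h w.
Proof.
move=> kl; rewrite -(subnK kl); elim: (l - k)%N => [|e ih].
  by split => [Uw|[]//]; split => // h; rewrite add0n => /andP[a b]; have := leq_ltn_trans a b; rewrite ltnn.
rewrite addSn stateS /=; split.
  move=> [/ih[Uk nu] ne]; split => // h /andP[kh]; rewrite ltnS leq_eqVlt => /orP[/eqP ->//|he].
  by apply: nu; rewrite kh.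
move=> [Uk nu]; split; last by apply: nu; rewrite leq_addl ltnSn.
by apply/ih; split => // h /andP[kh he]; apply: nu; rewrite kh ltnS ltnW.
Qed.

Lemma used_sub k w : used_ k w -> (state k).1 w.
Proof. by case. Qed.

Lemma trivIset_used_ : trivIset setT used_.
Proof.
suff key a b w : (a < b)%N -> used_ a w -> used_ b w -> False.
  move=> a b _ _ [w [ua ub]]; case: (ltngtP a b) => // h; exfalso.
    exact: key h ua ub.
  exact: key h ub ua.
move=> ab ua /used_sub; rewrite (state1_used w (leq0n b)) => -[_ /(_ a)].
by rewrite ab; apply.
Qed.

Definition unused : set Omega := ~` \bigcup_k used_ k.

Lemma measurable_unused : measurable unused.
Proof. by apply: measurableC; apply: bigcupT_measurable => k; exact: measurable_used_. Qed.

Lemma unused_state k w : unused w -> (state k).1 w.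
Proof.
move=> uw; apply/(state1_used w (leq0n k)); split => // h _ uh; apply: uw.
by exists h.
Qed.

Definition free w : R := limn (fun k => (state k).2 w).

Lemma free_cvg w : (fun k => (state k).2 w) @ \oo --> free w.
Proof.
apply: nonincreasing_is_cvgn.
  by apply/nonincreasing_seqP => k; exact: state2_le.
by exists 0%R => _ [k _ <-]; have [_ _ + _] := state_inv k; apply.
Qed.

Lemma free_ge0 w : (0 <= free w)%R.
Proof.
apply: limr_ge; first exact: free_cvg.
by apply: nearW => k; have [_ _ + _] := state_inv k; apply.
Qed.

Lemma free_le k w : (free w <= (state k).2 w)%R.
Proof.
apply: nonincreasing_cvgn_ge; last exact: free_cvg.
by apply/nonincreasing_seqP => h; exact: state2_le.
Qed.

Lemma free_le1 w : (free w <= 1)%R.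
Proof. exact: (free_le 0). Qed.

Lemma measurable_free : measurable_fun setT free.
Proof.
apply: (measurable_fun_cvg (h := fun k w => (state k).2 w)).
  by move=> k; have [_ + _ _] := state_inv k.
by move=> w _; exact: free_cvg.
Qed.

(** The sets [used_ k] are disjoint, so the choice of [k] is forced and measurability follows from a
    countable union. *)
Definition shift w : option V :=
  match pselect (exists k, used_ k w) with
  | left h => Some (disp_ (projT1 (cid h)) w)
  | right _ => None
  end.

Lemma shift_used k w : used_ k w -> shift w = Some (disp_ k w).
Proof.
move=> uk; rewrite /shift; case: pselect => [h|[]]; last by exists k.
congr (Some (disp_ _ w)); case: (cid h) => l /= ul.
by apply: trivIset_used_ => //; exists w.
Qed.

Lemma shift_unused w : shift w = None <-> unused w.
Proof.
rewrite /shift; case: pselect => h; split => //.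
  by move=> uw; exfalso; apply: uw; case: h => k uk; exists k.
by move=> _ [k _ uk]; apply: h; exists k.
Qed.

Lemma shift_SomeP w (Q : V -> Prop) : (exists2 v, shift w = Some v & Q v) <->
  exists2 k, used_ k w & Q (disp_ k w).
Proof.
split => [[v]|[k uk Qk]]; last by exists (disp_ k w) => //; exact: shift_used.
rewrite /shift; case: pselect => // h [<-]; case: (cid h) => k /= uk Qk.
by exists k.
Qed.

Lemma measurable_shift d (T : measurableType d) (a : T -> Omega) (b : T -> V) C :
  measurable_fun setT a -> measurable_fun setT b -> measurable C ->
  measurable [set x | exists2 v, shift (a x) = Some v & C (b x + v)%R].
Proof.
move=> ma mb mC.
rewrite [X in measurable X](_ : _ = \bigcup_k ([set x | used_ k (a x)] `&`
   [set x | C (b x + disp_ k (a x))%R])).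
  apply: bigcupT_measurable => k; apply: measurableI.
    exact: (measurable_preimageT ma (measurable_used_ k)).
  apply: (measurable_preimageT _ mC); apply: measurable_funD_rV => //.
  exact: (measurableT_comp (measurable_disp_ k) ma).
apply/seteqP; split => x /=.
  by move=> /(shift_SomeP _ (fun v => C (b x + v)%R))[k uk Ck]; exists k.
by move=> [k _ [uk Ck]]; apply/(shift_SomeP _ (fun v => C (b x + v)%R)); exists k.
Qed.

Let mtheta w : measurable_fun setT (fun z => theta z w).
Proof. by apply: measurable_flow2. Qed.

Let m_free w : measurable_fun setT (fun y => (free (theta y w))%:E).
Proof. by apply/measurable_EFinP; exact: (measurableT_comp measurable_free (mtheta w)). Qed.

Section at_good_point.
Variable w : Omega.
Hypotheses (xw : equivariant_at theta xi w) (ew : equivariant_at theta eta w)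
  (zw : equivariant_at theta zeta w).
Hypothesis dw : forall x, xi w [set x] = 0.

Lemma total_balance C : measurable C ->
  xi w [set s | exists2 v, shift (theta s w) = Some v & C (s + v)%R] =
  \int[eta w]_(y in C) (1 - free (theta y w))%:E.
Proof.
move=> mC.
have mE k : measurable [set s | used_ k (theta s w) /\ C (s + disp_ k (theta s w))%R].
  apply: measurableI; first exact: (measurable_preimageT _ (measurable_used_ k)).
  apply: (measurable_preimageT _ mC); apply: measurable_funD_rV => //.
  exact: (measurableT_comp (measurable_disp_ k) (mtheta w)).
rewrite [LHS](_ : _ = xi w (\bigcup_k [set s | used_ k (theta s w) /\ C (s + disp_ k (theta s w))%R])); last first.
  congr (xi w _); apply/seteqP; split => s /=.
    by move=> /(shift_SomeP _ (fun v => C (s + v)%R))[k uk Ck]; exists k.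
  by move=> [k _ [uk Ck]]; apply/(shift_SomeP _ (fun v => C (s + v)%R)); exists k.
rewrite measure_semi_bigcup//; last 2 first.
- move=> a b _ _ [s [[ua _] [ub _]]]; apply: trivIset_used_ => //.
  by exists (theta s w).
- exact: bigcupT_measurable.
transitivity (\sum_(k <oo) \int[eta w]_(y in C)
   ((state k).2 (theta y w) - (state k.+1).2 (theta y w))%:E).
  apply: eq_eseriesr => k _; have [mU mf f0 f1] := state_inv k.
  by rewrite (step_balance flow mxi meta mzeta fxi feta fzeta eps0 (move k).1.1 (move k).1.2 (move k).2 mU mf f0 f1 xw ew zw dw).
rewrite -integral_nneseries//; last 2 first.
- move=> k; apply/measurable_EFinP; apply: measurable_funTS; apply: measurable_funB.
    by have [_ mf _ _] := state_inv k; exact: (measurableT_comp mf (mtheta w)).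
  by have [_ mf _ _] := state_inv k.+1; exact: (measurableT_comp mf (mtheta w)).
- by move=> k y _; rewrite lee_fin subr_ge0 state2_le.
apply: eq_integral => y _; apply: cvg_lim => //.
(* The partial sums telescope, starting from the density 1. *)
rewrite [X in X @ _ --> _](_ : _ = fun k => (1 - (state k).2 (theta y w))%:E); last first.
  apply/funext => k; elim: k => [|k ih]; first by rewrite big_nil /= subrr.
  by rewrite big_nat_recr//= ih -EFinD; congr EFin; rewrite addrA subrK.
apply/cvg_EFin; first exact: nearW.
by apply: cvgB; [exact: cvg_cst|exact: free_cvg].
Qed.

(** One visit suffices: its cells [grid N i] cover the whole space, and every pair of them is
    treated at some step. *)
Lemma leftover_product : (exists N, visit zeta eps N w) ->
  xi w [set s | unused (theta s w)] = 0 \/ \int[eta w]_y (free (theta y w))%:E = 0.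
Proof.
move=> [N vw].
have mun i : measurable [set s | grid N i s /\ unused (theta s w)].
  apply: measurableI; first exact: measurable_grid.
  by apply: (measurable_preimageT _ measurable_unused).
have dich i j : xi w [set s | grid N i s /\ unused (theta s w)] = 0 \/
    \int[eta w]_(y in grid N j) (free (theta y w))%:E = 0.
  (* The step of this pair empties one of its cells; later steps only decrease what is left. *)
  pose k := pickle (N, i, j); have [mU mf f0 f1] := state_inv k.
  have mk : move k = (N, i, j) by rewrite /move pickleK.
  have := step_exhaust flow mxi meta mzeta fxi feta fzeta eps0 (N := (move k).1.1)
    (move k).1.2 (move k).2 mU mf f0 f1 zw.
  rewrite {1}mk => /(_ vw) [h|h]; [left|right]; apply/eqP.
    rewrite -measure_le0 -h; apply: le_measure; rewrite ?inE//.
      apply: measurableI; first exact: measurable_grid.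
      by apply: (measurable_preimageT (mtheta w)); have [] := state_inv k.+1.
    move=> s [gs us]; split; first by rewrite mk.
    exact: (unused_state k.+1 us).
  rewrite eq_le; apply/andP; split; last first.
    by apply: integral_ge0 => y _; rewrite lee_fin free_ge0.
  rewrite -h mk/=; apply: ge0_le_integral => //.
  - exact: measurable_grid.
  - by move=> y _; rewrite lee_fin free_ge0.
  - by apply: measurable_funTS; exact: m_free.
  - apply: measurable_funTS; apply/measurable_EFinP.
    have [_ mf' _ _] := state_inv k.+1; rewrite stateS mk/= in mf'.
    exact: (measurableT_comp mf' (mtheta w)).
  - move=> y _; rewrite lee_fin; have := free_le k.+1 (theta y w).
    by rewrite stateS mk.
have cells (m : {measure set V -> \bar R}) :
    (forall i, m (grid N i) = 0) -> m setT = 0.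
  move=> mi; rewrite (_ : setT = \bigcup_i grid N i); last first.
    by apply/seteqP; split => // x _; exists (floor_rV N x).
  by apply: measure_bigcup0 => i _; [exact: measurable_grid|exact: mi].
have munused : measurable [set s | unused (theta s w)].
  by apply: (measurable_preimageT _ measurable_unused).
have [allx|] := pselect (forall i, xi w [set s | grid N i s /\ unused (theta s w)] = 0).
  left; have := cells (mrestr (xi w) munused) allx.
  by rewrite /= /mrestr setTI.
move=> /existsNP[i xi_i]; right.
have f0 y : (0 <= free (theta y w))%R by exact: free_ge0.
have mf : measurable_fun setT (fun y => free (theta y w)).
  exact: (measurableT_comp measurable_free (mtheta w)).
have := cells (mdensity (eta w) f0 mf); apply => j.
by have [/xi_i|] := dich i j.
Qed.

End at_good_point.
End matching.

(** * Mass transport *)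

Section stationary_kernels.
Local Open Scope ereal_scope.
Context {R : realType} {n : nat} {dO : measure_display} {Omega : measurableType dO}.
Local Notation V := 'rV[R]_n.
Variables (P : probability Omega R) (theta : V -> Omega -> Omega).
Hypothesis flow : measurable_flow theta.
Hypothesis stat : stationary_prob P theta.

Lemma stationary_integral x (h : Omega -> \bar R) : measurable_fun setT h ->
  (forall w, 0 <= h w) -> \int[P]_w h (theta x w) = \int[P]_w h w.
Proof.
move=> mh h0.
transitivity (\int[image_measure P (measurable_flow1 flow x)]_w h w).
  by rewrite ge0_integral_pushforward//; exact: measurable_flow1.
by apply: eq_measure_integral => A mA _; exact: stat.
Qed.

Lemma ge0_integral0_ae (h : Omega -> \bar R) : measurable_fun setT h ->
  (forall w, 0 <= h w) -> \int[P]_w h w = 0 <-> {ae P, forall w, h w = 0}.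
Proof.
move=> mh h0; have := @ae_eq_integral_abs _ _ _ P setT measurableT h mh.
under eq_integral do rewrite gee0_abs//.
move=> [h1 h2]; split => [/h1|h3].
  by apply: filterS => w; apply.
by apply: h2; apply: filterS h3.
Qed.

Definition int_rV (j : 'rV[int]_n) : V := \row_k (j ord0 k)%:~R.

Lemma floor_rV_shift j (x : V) : floor_rV 0 (x - int_rV j)%R = (floor_rV 0 x - j)%R.
Proof.
apply/rowP => k; rewrite !mxE !mul1r -intrN floorDrz ?intr_int//.
by rewrite intrKfloor.
Qed.

Lemma grid_shift i j : (fun z : V => z - int_rV j)%R @^-1` grid 0 i = grid 0 (i + j)%R.
Proof.
apply/seteqP; split => x; rewrite /grid/= floor_rV_shift.
  by move=> <-; rewrite subrK.
by move=> ->; rewrite addrK.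
Qed.

(** By stationarity every unit cell has the same mean, here 0, and countably many cells cover the
    space. *)
Lemma null_of_unit_cell (Z : Omega -> {measure set V -> \bar R}) :
  (forall A, measurable A -> measurable_fun setT (Z ^~ A)) ->
  {ae P, forall w, equivariant_at theta Z w} ->
  \int[P]_w Z w (grid 0 0%R) = 0 -> {ae P, forall w, Z w setT = 0}.
Proof.
move=> mZ eZ Z0.
have Zj (j : 'rV[int]_n) : {ae P, forall w, Z w (grid 0 j) = 0}.
  have h : {ae P, forall w, Z (theta (int_rV j) w) (grid 0 0%R) = 0}.
    apply/ge0_integral0_ae => //.
      apply: (measurableT_comp (mZ _ _) (measurable_flow1 flow _)).
      exact: measurable_grid.
    by rewrite (@stationary_integral (int_rV j) (fun w => Z w (grid 0 0%R)))//; apply: mZ; exact: measurable_grid.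
  apply: filterS2 eZ h => w -> //; last exact: measurable_grid.
  by rewrite grid_shift add0r.
have Zc (k : nat) : {ae P, forall w, Z w (cell k) = 0}.
  rewrite cellE; case: pickle_inv => [j|]; first exact: Zj.
  by apply: aeW => w; rewrite measure0.
apply: filterS (ae_foralln Zc) => w Zw; rewrite -bigcup_cell.
by apply: measure_bigcup0 => k _; [exact: measurable_cell|exact: Zw].
Qed.

End stationary_kernels.

(** * Nothing is left over *)

Section balance.
Local Open Scope ereal_scope.
Context {R : realType} {n : nat} {dO : measure_display} {Omega : measurableType dO}.
Local Notation V := 'rV[R]_n.
Variables (P : probability Omega R) (theta : V -> Omega -> Omega).
Hypothesis flow : measurable_flow theta.
Hypothesis stat : stationary_prob P theta.
Hypothesis erg : ergodic P theta.

Variables xi eta zeta : Omega -> {measure set V -> \bar R}.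
Hypothesis mxi : forall A, measurable A -> measurable_fun setT (xi ^~ A).
Hypothesis meta : forall A, measurable A -> measurable_fun setT (eta ^~ A).
Hypothesis mzeta : forall A, measurable A -> measurable_fun setT (zeta ^~ A).
Hypothesis fxi : forall w, locally_finite (xi w).
Hypothesis feta : forall w, locally_finite (eta w).
Hypothesis fzeta : forall w, locally_finite (zeta w).
Variable eps : R.
Hypothesis eps0 : (0 < eps)%R.

Definition good w := [/\ equivariant_at theta xi w, equivariant_at theta eta w,
  equivariant_at theta zeta w & forall x, xi w [set x] = 0].

Hypothesis ae_good : {ae P, forall w, good w}.
Hypothesis ae_visit : {ae P, forall w, exists p N, visit zeta eps N (theta p w)}.
Hypothesis same_mean : \int[P]_w xi w (grid 0 0%R) = \int[P]_w eta w (grid 0 0%R).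
Hypothesis finite_mean : \int[P]_w xi w (grid 0 0%R) < +oo.

Let sh := shift theta xi eta zeta eps.
Let un := unused theta xi eta zeta eps.
Let fr := free theta xi eta zeta eps.
Let Q : set V := grid 0 0%R.
Let mQ : measurable Q. Proof. exact: measurable_grid. Qed.

Let mtheta w : measurable_fun setT (fun z => theta z w).
Proof. by apply: measurable_flow2. Qed.

Let mun : measurable un. Proof. exact: measurable_unused. Qed.
Let mfr : measurable_fun setT fr. Proof. exact: measurable_free. Qed.
Let fr0 w : (0 <= fr w)%R. Proof. exact: free_ge0. Qed.
Let fr1 w : (fr w <= 1)%R. Proof. exact: free_le1. Qed.

Let mun_w w : measurable [set s | un (theta s w)].
Proof. exact: (measurable_preimageT (mtheta w) mun). Qed.

Let mfr_w w : measurable_fun setT (fun y => fr (theta y w)).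
Proof. exact: (measurableT_comp mfr (mtheta w)). Qed.

Let mtheta2 : measurable_fun setT (fun x : Omega * V => theta x.2 x.1).
Proof. by apply: measurable_flow2. Qed.

Let flux w (A B : set V) := xi w [set s | A s /\ exists2 v, sh (theta s w) = Some v & B (s + v)%R].

Let mflux_set w (A B : set V) : measurable A -> measurable B ->
  measurable [set s | A s /\ exists2 v, sh (theta s w) = Some v & B (s + v)%R].
Proof.
move=> mA mB; apply: measurableI => //.
by apply: (measurable_shift flow mxi meta mzeta fxi feta fzeta eps (mtheta w) _ mB).
Qed.

Let mflux (A B : set V) : measurable A -> measurable B -> measurable_fun setT (fun w => flux w A B).
Proof.
move=> mA mB.
have mE : measurable [set x : Omega * V | A x.2 /\
    exists2 v, sh (theta x.2 x.1) = Some v & B (x.2 + v)%R].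
  apply: measurableI; first exact: (measurable_preimageT measurable_snd mA).
  exact: (measurable_shift flow mxi meta mzeta fxi feta fzeta eps mtheta2 measurable_snd mB).
exact: (measurable_kernel_section mxi fxi mE).
Qed.

Let flux_shift (x : V) (A B : set V) : measurable A -> measurable B ->
  \int[P]_w flux w ((fun z => z - x)%R @^-1` A) ((fun z => z - x)%R @^-1` B) =
  \int[P]_w flux w A B.
Proof.
move=> mA mB; rewrite -(stationary_integral flow stat x (mflux mA mB))//.
apply: ae_eq_integral => //.
- by apply: mflux; exact: measurable_preimage_translate.
- exact: (measurableT_comp (mflux mA mB) (measurable_flow1 flow x)).
apply: filterS ae_good => w [xw _ _ _] _; rewrite /flux xw; last exact: mflux_set.
congr (xi w _); apply/seteqP; split => s /=; rewrite (flowD flow) subrK.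
  by move=> [As [v sv Bv]]; split => //; exists v => //; rewrite addrAC.
by move=> [As [v sv Bv]]; split => //; exists v => //; rewrite addrAC in Bv.
Qed.

(** Numbered by the opposite cell, so that mass from [Q] to cell [j] and mass from cell [- j] to [Q]
    get the same index. *)
Let ncell k : set V := [set x | pickle (- floor_rV 0 x)%R = k].

Let ncellE k : ncell k = if (pickle_inv k : option 'rV[int]_n) is Some i then grid 0 (- i)%R else set0.
Proof.
rewrite /ncell /grid; apply/seteqP; split => x /=.
  by move=> <-; rewrite pickleK_inv/= opprK.
by have := @pickle_invK 'rV[int]_n k; case: pickle_inv => //= i <- ->; rewrite opprK.
Qed.

Let measurable_ncell k : measurable (ncell k).
Proof. by rewrite ncellE; case: pickle_inv => // i; exact: measurable_grid. Qed.

(** Mass sent from [Q] is split by destination, mass received in [Q] by origin; corresponding terms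
    differ by an integer shift and agree in mean. *)
Lemma mass_transport : \int[P]_w flux w Q setT = \int[P]_w flux w setT Q.
Proof.
transitivity (\sum_(k <oo) \int[P]_w flux w Q (cell k)).
  rewrite -integral_nneseries//; last first.
    by move=> k; apply: mflux => //; exact: measurable_cell.
  apply: eq_integral => w _; rewrite /flux -measure_semi_bigcup.
  - congr (xi w _); apply/seteqP; split => s /=.
      move=> [Qs [v sv _]]; exists (pickle (floor_rV 0 (s + v)%R)) => //.
      by split => //; exists v.
    by move=> [k _ [Qs [v sv _]]]; split => //; exists v.
  - by move=> k; apply: mflux_set => //; exact: measurable_cell.
  - move=> a b _ _ [s [[_ [v sv <-]] [_ [v' sv' <-]]]].
    by move: sv'; rewrite sv => -[->].
  - by apply: bigcupT_measurable => k; apply: mflux_set => //; exact: measurable_cell.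
transitivity (\sum_(k <oo) \int[P]_w flux w (ncell k) Q); last first.
  rewrite -integral_nneseries//; last first.
    by move=> k; apply: mflux => //; exact: measurable_ncell.
  apply: eq_integral => w _; rewrite /flux -measure_semi_bigcup.
  - congr (xi w _); apply/seteqP; split => s /=.
      by move=> [k _ [_ h]]; split.
    by move=> [_ h]; exists (pickle (- floor_rV 0 s)%R).
  - by move=> k; apply: mflux_set => //; exact: measurable_ncell.
  - by move=> a b _ _ [s [[<- _] [<- _]]].
  - by apply: bigcupT_measurable => k; apply: mflux_set => //; exact: measurable_ncell.
apply: eq_eseriesr => k _; rewrite cellE ncellE; case: pickle_inv => [j|]; last first.
  apply: eq_integral => w _; rewrite /flux; congr (xi w _).
  by apply/seteqP; split => s /=; [case=> _ []|case].
rewrite -[RHS](flux_shift (int_rV j)) ?grid_shift ?addNr ?add0r//.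
exact: measurable_grid.
Qed.

Let left_xi w : {measure set V -> \bar R} := mrestr (xi w) (mun_w w).
Let left_eta w : {measure set V -> \bar R} :=
  mdensity (eta w) (fun y => fr0 (theta y w)) (mfr_w w).

Let mleft_xi A : measurable A -> measurable_fun setT (left_xi ^~ A).
Proof.
move=> mA; have mE : measurable [set x : Omega * V | A x.2 /\ un (theta x.2 x.1)].
  apply: measurableI; first exact: (measurable_preimageT measurable_snd mA).
  exact: (measurable_preimageT mtheta2 mun).
exact: (measurable_kernel_section mxi fxi mE).
Qed.

Let mintegral (h : Omega -> R) A : measurable_fun setT h -> (forall w, (0 <= h w)%R) ->
  measurable A -> measurable_fun setT (fun w => \int[eta w]_(y in A) (h (theta y w))%:E).
Proof.
move=> mh h0 mA.
rewrite [X in measurable_fun _ X](_ : _ = fun w => \int[eta w]_y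
   (h (theta y w) * \1_A y)%:E).
  apply: (@measurable_kernel_integral R n _ Omega eta meta feta (fun x =>
    (h (theta x.2 x.1) * \1_A x.2)%:E)).
    by move=> x; rewrite lee_fin mulr_ge0.
  apply/measurable_EFinP; apply: measurable_funM.
    exact: (measurableT_comp mh mtheta2).
  by apply: (measurableT_comp _ measurable_snd); exact: measurable_indic.
apply/funext => w; rewrite integral_mkcond; apply: eq_integral => y _.
by rewrite epatch_indic/= -EFinM.
Qed.

Let mleft_eta A : measurable A -> measurable_fun setT (left_eta ^~ A).
Proof. by move=> mA; exact: mintegral. Qed.

Let left_xi_equivariant w : good w -> equivariant_at theta left_xi w.
Proof.
move=> [xw _ _ _] x C mC; rewrite /left_xi/= /mrestr xw; last exact: measurableI.
by congr (xi w _); apply/seteqP; split => s /=; rewrite (flowD flow) subrK.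
Qed.

Let left_eta_equivariant w : good w -> equivariant_at theta left_eta w.
Proof.
move=> [_ ew _ _] x C mC; rewrite /left_eta/= /mdensity.
rewrite (@equivariant_integral _ _ _ _ theta eta w x C (fun y => (fr (theta y (theta x w)))%:E))//.
- by apply: eq_integral => y _; rewrite (flowD flow) subrK.
- by apply/measurable_EFinP; exact: (mfr_w (theta x w)).
- by move=> y; rewrite lee_fin.
Qed.

(** In [Q], [xi] is left-over plus mass sent and [eta] is left-over plus mass received. The two
    transported means agree and are finite, hence cancel. *)
Let same_leftover : \int[P]_w left_xi w Q = \int[P]_w left_eta w Q.
Proof.
have mt : \int[P]_w flux w Q setT < +oo.
  apply: le_lt_trans finite_mean; apply: ge0_le_integral => //.
  - exact: mflux.
  - exact: mxi.
  - move=> w _; apply: le_measure; rewrite ?inE//; first exact: mflux_set.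
    by move=> s [].
have e1 : \int[P]_w xi w Q = \int[P]_w left_xi w Q + \int[P]_w flux w Q setT.
  rewrite -ge0_integralD//; last 2 first.
  - exact: mleft_xi.
  - exact: mflux.
  apply: eq_integral => w _; rewrite /left_xi/= /mrestr /flux -measureU.
  - congr (xi w _); apply/seteqP; split => s /=; last by move=> [[]|[]].
    move=> Qs; case e : (sh (theta s w)) => [v|]; [right|left].
      by split => //; exists v.
    by split => //; apply/shift_unused.
  - exact: measurableI.
  - exact: mflux_set.
  - by rewrite -subset0 => s [[_ /shift_unused us] [_ [v]]]; rewrite /sh us.
have e2 : \int[P]_w eta w Q = \int[P]_w left_eta w Q + \int[P]_w flux w setT Q.
  have m1 : measurable_fun setT (fun w => (1 - fr w)%R) by apply: measurable_funB.
  have p1 w : (0 <= 1 - fr w)%R by rewrite subr_ge0.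
  transitivity (\int[P]_w (left_eta w Q + \int[eta w]_(y in Q) (1 - fr (theta y w))%:E)).
    apply: eq_integral => w _; rewrite /left_eta/= /mdensity -ge0_integralD//.
    - under eq_integral do rewrite -EFinD addrC subrK.
      by rewrite integral_cst// mul1e.
    - by move=> y _; rewrite lee_fin.
    - by apply: measurable_funTS; apply/measurable_EFinP; exact: mfr_w.
    - by move=> y _; rewrite lee_fin.
    - apply: measurable_funTS; apply/measurable_EFinP.
      exact: (measurableT_comp m1 (mtheta w)).
  rewrite ge0_integralD//; last 3 first.
  - exact: mleft_eta.
  - by move=> w _; apply: integral_ge0 => y _; rewrite lee_fin.
  - exact: (mintegral m1 p1 mQ).
  congr (_ + _); apply: ae_eq_integral => //.
  - exact: (mintegral m1 p1 mQ).
  - exact: mflux.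
  apply: filterS ae_good => w [xw ew zw dw] _.
  rewrite -(total_balance flow mxi meta mzeta fxi feta fzeta eps0 xw ew zw dw mQ).
  by congr (xi w _); apply/seteqP; split => s /=; [move=> h; split|case].
move: same_mean; rewrite e1 e2 -mass_transport.
have mf : \int[P]_w flux w Q setT \is a fin_num by rewrite ge0_fin_numE// integral_ge0.
by move=> /(congr1 (fun z => z - \int[P]_w flux w Q setT)); rewrite !addeK.
Qed.

Let leftover_null : {ae P, forall w, left_xi w setT = 0 /\ left_eta w setT = 0}.
Proof.
have dich : {ae P, forall w, left_xi w setT = 0 \/ left_eta w setT = 0}.
  apply: filterS2 ae_good ae_visit => w gw [p [N vp]].
  have pT : (fun z : V => z - p)%R @^-1` setT = setT by [].
  have := left_xi_equivariant gw p measurableT; rewrite pT => <-.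
  have := left_eta_equivariant gw p measurableT; rewrite pT => <-.
  have zp : equivariant_at theta zeta (theta p w).
    by apply: equivariant_flow => //; case: gw.
  have := leftover_product flow mxi meta mzeta fxi feta fzeta eps0 zp (ex_intro _ N vp).
  by rewrite /left_xi/= /mrestr setTI.
have ae_xi : {ae P, forall w, equivariant_at theta left_xi w}.
  by apply: filterS ae_good => w; exact: left_xi_equivariant.
have ae_eta : {ae P, forall w, equivariant_at theta left_eta w}.
  by apply: filterS ae_good => w; exact: left_eta_equivariant.
have from_xi : {ae P, forall w, left_xi w setT = 0} -> \int[P]_w left_xi w Q = 0.
  move=> h; apply/ge0_integral0_ae => //; first exact: mleft_xi.
  apply: filterS h => w h; apply/eqP; rewrite -measure_le0 -h.
  by apply: le_measure; rewrite ?inE.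
have from_eta : {ae P, forall w, left_eta w setT = 0} -> \int[P]_w left_eta w Q = 0.
  move=> h; apply/ge0_integral0_ae => //; first exact: mleft_eta.
  apply: filterS h => w h; apply/eqP; rewrite -measure_le0 -h.
  by apply: le_measure; rewrite ?inE.
have null_xi := null_of_unit_cell flow stat mleft_xi ae_xi.
have null_eta := null_of_unit_cell flow stat mleft_eta ae_eta.
suff [h|h] : {ae P, forall w, left_xi w setT = 0} \/ {ae P, forall w, left_eta w setT = 0}.
- have h' : {ae P, forall w, left_eta w setT = 0}.
    by apply: null_eta; rewrite -same_leftover from_xi.
  by apply: filterS2 h h' => w.
- have h' : {ae P, forall w, left_xi w setT = 0}.
    by apply: null_xi; rewrite same_leftover from_eta.
  by apply: filterS2 h' h => w.
(* The dichotomy holds realisation by realisation; the 0-1 law for [A] makes the same alternative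
   hold almost surely. *)
pose A := [set w | left_xi w setT = 0].
have mA : measurable A.
  rewrite (_ : A = (left_xi ^~ setT) @^-1` [set 0]).
    by apply: measurable_preimageT; [exact: mleft_xi|exact: emeasurable_set1].
  by apply/seteqP; split.
have A01 : P A = 0 \/ P A = 1.
  apply: (ae_invariant_0_1 flow erg mA ae_good) => w gw x.
  by rewrite /A/= (left_xi_equivariant gw)// preimage_setT.
case: A01 => PA; [right|left].
  apply: filterS2 dich (_ : {ae P, forall w, ~ A w}) => [w [|//]|].
    by [].
  by exists A; split => // w /=; rewrite notK.
exists (~` A); split => //; first exact: measurableC.
by rewrite probability_setC// PA subee.
Qed.

Lemma shift_balances : {ae P, forall w,
  xi w [set s | sh (theta s w) = None] = 0 /\
  forall C, measurable C ->
    xi w [set s | exists2 v, sh (theta s w) = Some v & C (s + v)%R] = eta w C}.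
Proof.
apply: filterS2 ae_good leftover_null => w [xw ew zw dw] [lx ly]; split.
  rewrite -lx /left_xi/= /mrestr setTI; congr (xi w _).
  by apply/seteqP; split => s /shift_unused.
move=> C mC.
rewrite (total_balance flow mxi meta mzeta fxi feta fzeta eps0 xw ew zw dw mC).
have lC : left_eta w C = 0.
  by apply/eqP; rewrite -measure_le0 -ly; apply: le_measure; rewrite ?inE.
have fC : \int[eta w]_(y in C) (fr (theta y w))%:E = 0 by exact: lC.
transitivity (\int[eta w]_(y in C) (fr (theta y w))%:E +
  \int[eta w]_(y in C) (1 - fr (theta y w))%:E); first by rewrite fC add0e.
rewrite -ge0_integralD//.
- under eq_integral do rewrite -EFinD addrC subrK.
  by rewrite integral_cst// mul1e.
- by move=> y _; rewrite lee_fin.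
- by apply: measurable_funTS; apply/measurable_EFinP; exact: (mfr_w w).
- by move=> y _; rewrite lee_fin subr_ge0 fr1.
- by apply: measurable_funTS; apply/measurable_EFinP; apply: measurable_funB.
Qed.

End balance.

(** * Reduction of the hypotheses *)

Section locally_finite_part.
Local Open Scope ereal_scope.
Context {R : realType} {n : nat} {dO : measure_display} {Omega : measurableType dO}.
Local Notation V := 'rV[R]_n.
Variables (P : probability Omega R) (theta : V -> Omega -> Omega).
Hypothesis flow : measurable_flow theta.
Variable k : R.-ker Omega ~> V.

Let lf : set Omega := [set w | locally_finite (k w)].

Let measurable_lf : measurable lf.
Proof.
rewrite (_ : lf = ~` \bigcup_i (~` [set w | k w (grid 0 i) < +oo])); last first.
  by rewrite setC_bigcup; apply/seteqP; split => w h i; [move=> _; rewrite /= notK; exact: h|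
    have := h i I; rewrite /= notK].
apply: measurableC; apply: count_bigcup_measurable => i _; apply: measurableC.
rewrite -[X in measurable X]setTI; apply: emeasurable_fun_infty_o => //.
by apply: measurable_kernel; exact: measurable_grid.
Qed.

(** The zero measure replaces the kernel on exceptional realisations, so that local finiteness,
    which measurability rests on, holds for every [w]. *)
Definition lf_part w : {measure set V -> \bar R} :=
  if w \in lf then k w else mzero.

Lemma measurable_lf_part A : measurable A -> measurable_fun setT (lf_part ^~ A).
Proof.
move=> mA.
rewrite [X in measurable_fun _ X](_ : _ = fun w => if w \in lf then k w A else 0); last first.
  by apply/funext => w; rewrite /lf_part; case: ifPn.
by apply: measurable_fun_if_set => //; exact: measurable_kernel.
Qed.

Lemma locally_finite_lf_part w : locally_finite (lf_part w).
Proof. by rewrite /lf_part; case: ifPn => [/set_mem//|_ i]; rewrite /mzero/= ltry. Qed.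

Let grid_translate (i : 'rV[int]_n) (x : V) : (fun z : V => z - x)%R @^-1` grid 0 i `<=`
  closed_box (int_rV i + x)%R (int_rV i + const_mx 1 + x)%R.
Proof.
move=> z; rewrite gridE /= => zi l; have := zi l; rewrite !mxE mul1r intrD /=.
by move=> /andP[? ?]; apply/andP; split; lra.
Qed.

(** Equivariance compares [w] with all its shifts, so none of them may be exceptional: a shifted
    cell lies in a compact box, of finite mass under [k w]. *)
Lemma lf_partE w x : (forall K, compact K -> k w K < +oo) ->
  (forall (y : V) (C : set V), measurable C -> k (theta y w) [set (c - y)%R | c in C] = k w C) ->
  lf_part (theta x w) = k (theta x w).
Proof.
move=> kK kE; rewrite /lf_part mem_set// => i.
have mgi : measurable ((fun z : V => z - x)%R @^-1` grid 0 i).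
  by apply: measurable_preimage_translate; exact: measurable_grid.
have <- : [set (c - x)%R | c in (fun z : V => z - x)%R @^-1` grid 0 i] = grid 0 i.
  by rewrite image_translate; apply/seteqP; split => z /=; rewrite addrK.
have lt : k w (closed_box (int_rV i + x)%R (int_rV i + const_mx 1 + x)%R) < +oo.
  by apply: kK; exact: compact_closed_box.
rewrite kE//; apply: le_lt_trans lt.
by apply: le_measure; rewrite ?inE//; exact: measurable_closed_box.
Qed.

Hypotheses (rk : random_measure P k) (sk : stationary_rm P theta k).

Lemma ae_lf_part : {ae P, forall w, [/\ lf_part w = k w, equivariant_at theta lf_part w &
  forall K, compact K -> lf_part w K < +oo]}.
Proof.
apply: filterS2 rk sk => w kK kE.
have e0 : lf_part w = k w.
  by have := lf_partE 0%R kK kE; have [_ -> _] := flow.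
split=> //; last by move=> K; rewrite e0; exact: kK.
move=> x C mC; rewrite (lf_partE x kK kE) e0.
rewrite -(kE x ((fun z => z - x)%R @^-1` C)); last exact: measurable_preimage_translate.
congr (k _ _); rewrite image_translate.
by apply/seteqP; split => z /=; rewrite addrK.
Qed.

End locally_finite_part.

(** * Non-diffuse measures provide origins *)

Section atoms.
Local Open Scope ereal_scope.
Context {R : realType} {n : nat} {dO : measure_display} {Omega : measurableType dO}.
Local Notation V := 'rV[R]_n.
Variables (P : probability Omega R) (theta : V -> Omega -> Omega).

(** Without atoms, every point has a rational box of mass below 1, hence of mass 0 by integrality,
    and there are countably many such boxes. *)
Lemma integer_diffuse_eq0 (m : {measure set V -> \bar R}) :
  (forall K, compact K -> m K < +oo) -> (forall x, m [set x] = 0) ->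
  (forall C, measurable C -> m C = +oo \/ exists j : nat, m C = (j%:R)%:E) ->
  m setT = 0.
Proof.
move=> mK m0 mN.
have -> : [set: V] = \bigcup_(c in [set c | m (rat_box c) = 0]) rat_box c.
  apply/seteqP; split => // x _.
  have [N hN] := punctured_cube_small ltr01 x mK.
  have [|c cx cN] := @rat_box_nbhs R n x [set y | cube N (y - x)%R].
    apply/nbhs_ballP; exists (N.+1%:R^-1)%R => /=; first by rewrite invr_gt0.
    by move=> y [_ xy] i; rewrite !mxE distrC; exact: (xy ord0 i).
  exists c => //=; have mc : measurable (rat_box c : set V) by exact: measurable_rat_box.
  have mcube : measurable [set y : V | cube N (y - x)%R].
    exact: (measurable_preimageT (measurable_translate (- x)%R) (measurable_cube N)).
  have lt1 : m (rat_box c) < 1.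
    apply: le_lt_trans hN.
    rewrite -[leRHS]adde0 -(m0 x).
    have mD : measurable ([set y : V | cube N (y - x)%R] `\ x).
      by apply: measurableD => //; exact: measurable_set1_rV.
    apply: le_trans (measureU2 _ mD (measurable_set1_rV x)).
    apply: le_measure; rewrite ?inE//; first by apply: measurableU => //; exact: measurable_set1_rV.
    move=> y cy; have [->|yx] := eqVneq y x; [by right|left].
    by split; [exact: cN|exact/eqP].
  by case: (mN _ mc) => [e|[[//|j] e]]; move: lt1; rewrite e// lte_fin ltrn1.
by apply: measure_bigcup0 => c //= _; exact: measurable_rat_box.
Qed.

Lemma auxiliary_pp_not_diffuse (chi : R.-ker Omega ~> V) :
  auxiliary_pp P theta chi -> ~ diffuse P chi.
Proof.
move=> [[[chiK chiN] _] chi0 _ _] dchi; apply: chi0.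
apply: filterS2 chiK dchi => w wK wd.
exact: integer_diffuse_eq0 wK wd (chiN w).
Qed.

Hypothesis flow : measurable_flow theta.
Hypothesis erg : ergodic P theta.
Variable zeta : Omega -> {measure set V -> \bar R}.
Hypothesis mzeta : forall A, measurable A -> measurable_fun setT (zeta ^~ A).
Hypothesis fzeta : forall w, locally_finite (zeta w).
Hypothesis ae_zeta : {ae P, forall w, equivariant_at theta zeta w /\
  forall K, compact K -> zeta w K < +oo}.

(** For each [eps] the existence of a visit is almost invariant, hence has probability 0 or 1. Were
    it 0 for all [eps = 1 / m.+1], there would be almost surely no atom, as any atom is at least
    that heavy for some [m]. *)
Lemma ae_visits : ~ {ae P, forall w, forall x, zeta w [set x] = 0} ->
  exists2 eps : R, (0 < eps)%R &
    {ae P, forall w, exists p N, visit zeta eps N (theta p w)}.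
Proof.
move=> nd.
(* Existence of a visit, expressed as positive [zeta]-mass of the set of visits, which makes it an
   event. *)
pose visits eps : set Omega :=
  \bigcup_N [set w | 0 < zeta w [set p | visit zeta eps N (theta p w)]].
have mvisits eps : measurable (visits eps).
  apply: bigcupT_measurable => N; rewrite -[X in measurable X]setTI.
  apply: emeasurable_fun_o_infty; first by [].
  have mE : measurable [set x : Omega * V | visit zeta eps N (theta x.2 x.1)].
    by apply: (measurable_preimageT _ (measurable_visit mzeta eps N)); apply: measurable_flow2.
  exact: (measurable_kernel_section mzeta fzeta mE).
have visitsP eps w : (0 < eps)%R -> equivariant_at theta zeta w ->
    visits eps w <-> exists p N, visit zeta eps N (theta p w).
  move=> eps0 zw; split.
    move=> [N _ /= h]; apply: contrapT => nv; move: h.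
    rewrite [X in zeta w X](_ : _ = set0) ?measure0 ?ltxx// -subset0 => p vp.
    by apply: nv; exists p, N.
  move=> [p [N vp]]; exists N => //=.
  apply: (@lt_le_trans _ _ eps%:E); first by rewrite lte_fin.
  apply: (@le_trans _ _ (zeta w [set p])).
    by case: vp => + _; rewrite (equivariant_set1 _ _ zw) add0r.
  apply: le_measure; rewrite ?inE; first exact: measurable_set1_rV.
    apply: (measurable_preimageT _ (measurable_visit mzeta eps N)).
    by apply: measurable_flow2.
  by move=> _ ->.
have v01 eps : (0 < eps)%R -> P (visits eps) = 0 \/ P (visits eps) = 1.
  move=> eps0; apply: (ae_invariant_0_1 flow erg (mvisits eps) ae_zeta) => w [zw _] x.
  rewrite (visitsP _ _ eps0 zw) (visitsP _ _ eps0 (equivariant_flow flow x zw)).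
  split => -[p [N vp]].
    by exists (p + x)%R, N; rewrite -(flowD flow).
  by exists (p - x)%R, N; rewrite (flowD flow) subrK.
have [[m Pm]|none] := pselect (exists m : nat, P (visits m.+1%:R^-1%R) = 1).
  exists (m.+1%:R^-1)%R; first by rewrite invr_gt0.
  have av : {ae P, forall w, visits (m.+1%:R^-1)%R w}.
    exists (~` visits (m.+1%:R^-1)%R); split => //; first exact: measurableC.
    by rewrite probability_setC// Pm subee.
  have e0 : (0 < m.+1%:R^-1 :> R)%R by rewrite invr_gt0.
  by apply: filterS2 ae_zeta av => w [zw _] /(visitsP _ _ e0 zw).
exfalso; apply: nd.
have nv (m : nat) : {ae P, forall w, ~ visits (m.+1%:R^-1)%R w}.
  exists (visits (m.+1%:R^-1)%R); split => //; last by move=> w /=; rewrite notK.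
  have [//|Pm] : P (visits (m.+1%:R^-1)%R) = 0 \/ P (visits (m.+1%:R^-1)%R) = 1.
    by apply: v01; rewrite invr_gt0.
  by exfalso; apply: none; exists m.
apply: filterS2 ae_zeta (ae_foralln nv) => w [zw zK] nw x.
apply/eqP; rewrite -measure_le0 leNgt; apply/negP => zx.
have fx : zeta w [set x] \is a fin_num.
  by rewrite ge0_fin_numE//; apply: zK; exact: compact_set1.
have zx0 : (0 < fine (zeta w [set x]))%R.
  by apply: fine_gt0; rewrite zx; apply: zK; exact: compact_set1.
have [m] := ltr_add_invr zx0; rewrite add0r => hm.
have e0 : (0 < m.+1%:R^-1 :> R)%R by rewrite invr_gt0.
have xe : (m.+1%:R^-1)%:E <= zeta w [set x].
  by apply: (@le_trans _ _ (fine (zeta w [set x]))%:E); [rewrite lee_fin ltW|rewrite (fineK fx)].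
apply: (nw m); apply/(visitsP _ _ e0 zw); exists x.
exact: (visit_exists e0 zw zK xe).
Qed.

End atoms.

(** * The closed unit cube and the half-open unit cell have the same mean *)

Section unit_cube.
Local Open Scope ereal_scope.
Context {R : realType} {n : nat} {dO : measure_display} {Omega : measurableType dO}.
Local Notation V := 'rV[R]_n.
Variables (P : probability Omega R) (theta : V -> Omega -> Omega).
Hypothesis flow : measurable_flow theta.
Hypothesis stat : stationary_prob P theta.
Variable Z : Omega -> {measure set V -> \bar R}.
Hypothesis mZ : forall A, measurable A -> measurable_fun setT (Z ^~ A).
Hypothesis eZ : {ae P, forall w, equivariant_at theta Z w}.
Hypothesis Zfin : \int[P]_w Z w unit_cube < +oo.

Let face (k : 'I_n) (t : R) : set V :=
  [set x | x ord0 k = t /\ forall l, l != k -> (0 <= x ord0 l <= 1)%R].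

Let measurable_face k t : measurable (face k t).
Proof.
rewrite (_ : face k t = (fun x : V => x ord0 k) @^-1` [set t] `&`
  \bigcap_(l in [set l | l != k]) ((fun x : V => x ord0 l) @^-1` `[0%R, 1%R]%classic)).
  apply: measurableI; first by apply: measurable_preimageT => //; exact: measurable_coord.
  apply: fin_bigcap_measurable; first exact: finite_finset.
  by move=> l _; apply: measurable_preimageT => //; exact: measurable_coord.
by apply/seteqP; split => x [xk h]; split => // l lk; have := h l lk; rewrite /= in_itv.
Qed.

Let measurable_unit_cube : measurable (@unit_cube R n).
Proof.
rewrite (_ : unit_cube = closed_box (0 : V)%R (const_mx 1%R)).
  exact: measurable_closed_box.
by apply/seteqP; split => x h l; have := h l; rewrite !mxE.
Qed.

Let mean_face k t : \int[P]_w Z w (face k t) = \int[P]_w Z w (face k 0%R).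
Proof.
rewrite -(stationary_integral flow stat (t *: delta_mx ord0 k)%R (mZ (measurable_face k 0%R)))//.
apply: ae_eq_integral => //; first exact: mZ.
  exact: (measurableT_comp (mZ (measurable_face k 0%R)) (measurable_flow1 flow _)).
apply: filterS eZ => w zw _; rewrite zw//; congr (Z w _).
apply/seteqP; split => x; rewrite /face/= !mxE !eqxx/= mulr1 => -[xk h].
  split; first by rewrite xk subrr.
  by move=> l lk; rewrite !mxE (negbTE lk) andbF mulr0 subr0; exact: h.
split; first by apply/eqP; rewrite -subr_eq0 xk.
by move=> l lk; have := h l lk; rewrite !mxE (negbTE lk) andbF mulr0 subr0.
Qed.

(* The unit cube contains infinitely many disjoint translates of each of its faces. *)
Let mean_face0 k t : \int[P]_w Z w (face k t) = 0.
Proof.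
rewrite mean_face; set c := \int[P]_w Z w (face k 0%R).
have c0 : 0 <= c by exact: integral_ge0.
pose G (j : nat) := face k (j.+1%:R^-1)%R.
have le_cube : \bigcup_j G j `<=` unit_cube.
  move=> x [j _ [xk h]] l; have [->|lk] := eqVneq l k; last exact: h.
  by rewrite xk invr_ge0 ler0n/= invf_le1// ler1n.
have tG : trivIset setT G.
  move=> a b _ _ [x [[e1 _] [e2 _]]]; move: e2; rewrite e1 => /invr_inj/eqP.
  by rewrite eqr_nat eqSS => /eqP.
have mG j : measurable (G j) by exact: measurable_face.
have sum_c : \sum_(j <oo) c <= \int[P]_w Z w unit_cube.
  rewrite (eq_eseriesr (g := fun j => \int[P]_w Z w (G j))); last by move=> j _; rewrite mean_face.
  rewrite -integral_nneseries//; last by move=> j; exact: mZ.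
  apply: ge0_le_integral => //.
  - by move=> w _; apply: nneseries_ge0.
  - by apply: ge0_emeasurable_sum => // j _; exact: mZ.
  - exact: mZ.
  move=> w _; rewrite -measure_semi_bigcup//; last exact: bigcupT_measurable.
  by apply: le_measure; rewrite ?inE//; exact: bigcupT_measurable.
apply/eqP; rewrite eq_le c0 andbT leNgt; apply/negP => cp.
have cfin : c \is a fin_num.
  rewrite ge0_fin_numE//; apply: le_lt_trans Zfin; apply: le_trans sum_c.
  by rewrite (nneseries_split 0%N 1%N)// big_nat1 leeDl// nneseries_ge0.
have lfin : \int[P]_w Z w unit_cube \is a fin_num by rewrite ge0_fin_numE// integral_ge0.
rewrite -(fineK cfin) lte_fin in cp.
pose a := fine (\int[P]_w Z w unit_cube).
have r0 : (0 <= a / fine c)%R by rewrite divr_ge0 ?fine_ge0// integral_ge0.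
pose M := Num.bound (a / fine c)%R.
have aM : (a < M%:R * fine c)%R by rewrite -ltr_pdivrMr//; exact: archi_boundP.
move: aM; rewrite ltNge => /negP; apply.
rewrite -lee_fin (fineK lfin); apply: le_trans sum_c.
apply: le_trans (nneseries_lim_ge M (fun j _ _ => c0)).
by rewrite big_mkord -(fineK cfin) sumEFin sumr_const card_ord mulr_natl.
Qed.

(** Intensity is defined on the closed cube, mass transport works with the cell; they differ by the
    faces [x_k = 1], which are almost surely null. *)
Lemma mean_unit_cube : \int[P]_w Z w unit_cube = \int[P]_w Z w (grid 0 0%R).
Proof.
have fk (k : 'I_n) : {ae P, forall w, Z w (face k 1%R) = 0}.
  have [+ _] := ge0_integral0_ae P (mZ (measurable_face k 1%R)) (fun w => measure_ge0 (Z w) _).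
  by apply; exact: mean_face0.
have mG : measurable (@grid R n 0 0%R) by exact: measurable_grid.
apply: ae_eq_integral => //; [exact: mZ|exact: mZ|].
apply: filterS (filter_forall _ fk) => w Zk _; apply/eqP; rewrite eq_le; apply/andP; split.
  have F0 : Z w (\bigcup_(k in [set: 'I_n]) face k 1%R) = 0.
    by apply: measure_bigcup0 => k _; [exact: measurable_face|exact: Zk].
  have mF : measurable (\bigcup_(k in [set: 'I_n]) face k 1%R).
    by apply: count_bigcup_measurable => k _; exact: measurable_face.
  rewrite -[leRHS]adde0 -F0; apply: le_trans (measureU2 _ mG mF).
  apply: le_measure; rewrite ?inE//; first exact: measurableU.
  move=> x xc; have [[k xk]|nk] := pselect (exists k, x ord0 k = 1%R).
    by right; exists k => //; split.
  left; rewrite gridE => k; rewrite !mxE mul1r add0r.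
  have /andP[x0 x1] := xc k; rewrite x0/= lt_neqAle x1 andbT.
  by apply/eqP => xk; apply: nk; exists k.
apply: le_measure; rewrite ?inE// => x; rewrite gridE => /= xg k.
by have := xg k; rewrite !mxE mul1r add0r => /andP[-> /ltW].
Qed.

End unit_cube.

(** * Construction of the balancing allocation *)

Local Open Scope ereal_scope.

Theorem theorem1p1 (R : realType) (d : nat) (hd : (0 < d)%N)
  (dO : measure_display) (Omega : measurableType dO)
  (P : probability Omega R) (theta : 'rV[R]_d -> Omega -> Omega)
  (xi eta : R.-ker Omega ~> 'rV[R]_d) :
  measurable_flow theta ->
  stationary_prob P theta ->
  ergodic P theta ->
  random_measure P xi -> random_measure P eta ->
  stationary_rm P theta xi -> stationary_rm P theta eta ->
  diffuse P xi ->
  0 < intensity P xi -> intensity P xi = intensity P eta ->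
  intensity P xi < +oo ->
  (~ diffuse P eta \/
   (diffuse P eta /\ exists chi : R.-ker Omega ~> 'rV[R]_d,
                       auxiliary_pp P theta chi)) ->
  exists tau : Omega -> 'rV[R]_d -> option 'rV[R]_d,
    allocation P theta tau /\ balances P xi eta tau.
Proof.
move=> flow stat erg rxi reta sxi seta dxi mean0 mean_eq mean_fin aux.
(* Both cases supply the same thing, a stationary random measure that is not diffuse; from here on
   they are not distinguished. *)
have [zeta [rzeta szeta nzeta]] : exists zeta : R.-ker Omega ~> 'rV[R]_d,
    [/\ random_measure P zeta, stationary_rm P theta zeta & ~ diffuse P zeta].
  case: aux => [neta|[_ [chi chi_aux]]]; first by exists eta.
  exists chi; split; last exact: auxiliary_pp_not_diffuse chi_aux.
    by case: chi_aux => [[[]]].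
  by case: chi_aux.
pose X := lf_part xi; pose E := lf_part eta; pose Z := lf_part zeta.
have mX := measurable_lf_part xi; have fX := locally_finite_lf_part xi.
have mE := measurable_lf_part eta; have fE := locally_finite_lf_part eta.
have mZ := measurable_lf_part zeta; have fZ := locally_finite_lf_part zeta.
have aX := ae_lf_part flow rxi sxi; have aE := ae_lf_part flow reta seta.
have aZ := ae_lf_part flow rzeta szeta.
have [eps eps0 visits] : exists2 eps : R, (0 < eps)%R &
    {ae P, forall w, exists p N, visit Z eps N (theta p w)}.
  apply: (ae_visits flow erg mZ fZ); first by apply: filterS aZ => w [].
  move=> dZ; apply: nzeta; apply: filterS2 aZ dZ => w [eZ _ _] dw x.
  by have := dw x; rewrite -eZ.
have gw : {ae P, forall w, good theta X E Z w}.
  apply: filterS2 (filterI aX aE) (filterI aZ dxi) => w [[x1 x2 _] [_ e2 _]] [[_ z2 _] dw].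
  by split => // x; rewrite /X x1.
have mcube : measurable (@unit_cube R d).
  rewrite (_ : unit_cube = closed_box (0 : 'rV[R]_d)%R (const_mx 1%R)).
    exact: measurable_closed_box.
  by apply/seteqP; split => x h l; have := h l; rewrite !mxE.
(* Passing to [lf_part] changes the kernel on a null event only, so the cell means are still the
   intensities. *)
have mean_lf (k : R.-ker Omega ~> 'rV[R]_d) : random_measure P k ->
    stationary_rm P theta k -> intensity P k < +oo ->
    \int[P]_w lf_part k w (grid 0 0%R) = intensity P k.
  move=> rk sk kfin; have ak := ae_lf_part flow rk sk.
  have kE : \int[P]_w lf_part k w unit_cube = intensity P k.
    apply: ae_eq_integral => //; first exact: measurable_lf_part.
      exact: measurable_kernel.
    by apply: filterS ak => w [-> _ _].
  rewrite -(mean_unit_cube flow stat (measurable_lf_part k)) ?kE//.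
  by apply: filterS ak => w [].
have XE : \int[P]_w X w (grid 0 0%R) = \int[P]_w E w (grid 0 0%R).
  by rewrite !mean_lf -?mean_eq.
have Xfin : \int[P]_w X w (grid 0 0%R) < +oo by rewrite mean_lf.
have bal := shift_balances flow stat erg mX mE mZ fX fE fZ eps0 gw visits XE Xfin.
pose sh := shift theta X E Z eps.
exists (fun w x => omap (fun v => x + v)%R (sh (theta x w))); split.
  split.
  - rewrite (_ : [set p : Omega * 'rV[R]_d | _] =
       (fun p => theta p.2 p.1) @^-1` unused theta X E Z eps).
      apply: measurable_preimageT; first by apply: measurable_flow2.
      exact: measurable_unused.
    apply/seteqP; split => p /=; first by case e : (sh _) => // _; exact/shift_unused.
    by move=> /shift_unused; rewrite -/sh => ->.
  - move=> C mC.
    have mt : measurable_fun setT (fun p : Omega * 'rV[R]_d => theta p.2 p.1).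
      by apply: measurable_flow2.
    have := measurable_shift flow mX mE mZ fX fE fZ eps mt measurable_snd mC.
    congr measurable; apply/seteqP; split => p /=.
      by move=> [v sv Cv]; exists (p.2 + v)%R => //; rewrite /sh sv.
    by rewrite /sh; case: (shift _ _ _ _ _ _) => [v|] [y]//= [<-] Cy; exists v.
  - apply: aeW => w x y; rewrite (flowD flow) subrK.
    by case: (sh _) => //= v; rewrite addrAC.
apply: filterS2 bal (filterI aX aE) => w [b0 bC] [[x1 _ _] [e1 _ _]].
rewrite -x1 -e1; split.
  rewrite -b0; congr (X w _); apply/seteqP; split => s /=; rewrite -/sh;
    by case: (sh _).
move=> C mC; rewrite -bC// integral_indic//.
  rewrite setIT; congr (X w _); apply/seteqP; split => s /=; rewrite -/sh.
    by case: (sh _) => [v|] [y]//= [<-] Cy; exists v.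
  by move=> [v -> Cv]; exists (s + v)%R.
have mt : measurable_fun setT (fun s : 'rV[R]_d => theta s w).
  by apply: measurable_flow2.
have := measurable_shift flow mX mE mZ fX fE fZ eps mt (b := fun s => s) _ mC.
move=> /(_ (@measurable_id _ _ _)); congr measurable; apply/seteqP; split => s /=; rewrite -/sh.
  by move=> [v -> Cv]; exists (s + v)%R.
by case: (sh _) => [v|] [y]//= [<-] Cy; exists v.
Qed.
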